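(* Let $\mu,\nu$ be two solutions in $C([0,T],\mathcal{P}^{ac}_c)$ of $\partial_t\mu+\nabla\cdot(v[\mu]\mu)=0$ (with initial data $\mu_0$ and $\nu_0$ respectively), with $v$ satisfying hypothesis (H) with constants $L,M,K$. Then, for all $t\in[0,T]$, $$W_p(\mu_t,\nu_t)\le (2e)^{\lceil t\max\{2L,8K\}\rceil}\,W_p(\mu_0,\nu_0),$$ where $\lceil x\rceil$ is the smallest integer not less than $x$. In particular, if $\mu_0=\nu_0$, then $\mu_t=\nu_t$ for all $t\in[0,T]$.
   Context: Fix $p\ge 1$, $n\in\mathbb{N}$, $T>0$. $\mathcal{P}_p$ is the space of Radon probability measures on $\mathbb{R}^n$ with finite $p$-moment, endowed with the Wasserstein distance $W_p$; for absolutely continuous measures $W_p(\mu,\nu)=\inf\{(\int|\gamma(x)-x|^p d\mu)^{1/p}:\gamma\#\mu=\nu\}$, where $\gamma\#\mu(E)=\mu(\gamma^{-1}(E))$. $\mathcal{P}^{ac}_c\subset\mathcal{P}_p$ is the set of probability measures with compact support that are absolutely continuous with respect to Lebesgue measure, with the topology of $W_p$. Hypothesis (H): $v:\mathcal{P}_p\to C^1(\mathbb{R}^n)\cap L^\infty(\mathbb{R}^n)$, $\mu\mapsto v[\mu]$ (vector fields on $\mathbb{R}^n$), and there are constants $L,M,K$ such that for all $\mu,\nu\in\mathcal{P}_p$, $x,y\in\mathbb{R}^n$: $|v[\mu](x)-v[\mu](y)|\le L|x-y|$, $|v[\mu](x)|\le M$, $\|v[\mu]-v[\nu]\|_{C^0}\le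 K\,W_p(\mu,\nu)$. Solution with initial datum $\mu_0$: $\mu\in C([0,T],\mathcal{P}^{ac}_c)$ with $\mu_{|t=0}=\mu_0$ and $\int_0^T\int_{\mathbb{R}^n}(\partial_t f+\nabla f\cdot v[\mu_t])\,d\mu_t\,dt=0$ for all $f\in C_c^\infty((0,T)\times\mathbb{R}^n)$. *)

(* Defs.v *)
From HB Require Import structures.
From mathcomp Require Import all_boot all_order all_algebra.
From mathcomp Require Import all_classical all_reals all_analysis.

Set Implicit Arguments.
Unset Strict Implicit.
Unset Printing Implicit Defensive.

Import Order.TTheory GRing.Theory Num.Theory.
Import numFieldNormedType.Exports.

Local Open Scope classical_set_scope.
Local Open Scope ring_scope.

(* R^n is 'rV[R]_n; its topology (generated by the sup norm) is the usual one,
   and its sigma-algebra is the Borel one. *)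
HB.instance Definition _ (R : realType) (n : nat) :=
  @isMeasurable.Build (sigma_display (@open 'rV[R]_n)) 'rV[R]_n
    <<s @open 'rV[R]_n >> (@sigma_algebra0 _ setT _) (@sigma_algebraC _ _)
    (@sigma_algebra_bigcup _ setT _).

Section euclidean_space.
Context {R : realType} {n : nat}.
Implicit Types (x y : 'rV[R]_n) (A : set 'rV[R]_n).

(* The library norm on 'rV[R]_n is the sup norm, hence the need for enorm. *)
Definition dotp x y : R := \sum_(i < n) x ord0 i * y ord0 i.

Definition enorm x : R := Num.sqrt (dotp x x).

Definition C0norm (w : 'rV[R]_n -> 'rV[R]_n) : \bar R :=
  ereal_sup [set (enorm (w x))%:E | x in [set: 'rV[R]_n]].

Definition C1 (w : 'rV[R]_n -> 'rV[R]_n) : Prop :=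
  (forall x, differentiable w x) /\ continuous (jacobian w).

Definition box x y : set 'rV[R]_n :=
  [set z | forall i : 'I_n, x ord0 i <= z ord0 i <= y ord0 i].

(* Lebesgue (outer) measure: infimum of the total volumes of the finite or
   countable covers by closed boxes.  D is the set of indices in use: finite
   covers are needed when n = 0, where every box has volume 1. *)
Definition lebesgue_rV A : \bar R :=
  ereal_inf [set l | exists D : pred nat, exists a b : nat -> 'rV[R]_n,
    [/\ forall k (i : 'I_n), a k ord0 i <= b k ord0 i,
        A `<=` \bigcup_(k in [set k | D k]) box (a k) (b k) &
        l = (\sum_(0 <= k <oo | D k)
               (\prod_(i < n) (b k ord0 i - a k ord0 i))%:E)%E]].

Definition abs_continuous (mu : set 'rV[R]_n -> \bar R) : Prop :=
  forall A, measurable A -> lebesgue_rV A = 0%E -> mu A = 0%E.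

Definition supp (mu : set 'rV[R]_n -> \bar R) : set 'rV[R]_n :=
  [set x | forall U : set 'rV[R]_n, open U -> U x -> (0 < mu U)%E].

End euclidean_space.

(* A measure is a function on all subsets, with arbitrary values on the
   non-measurable ones: equality of measures is equality on Borel sets. *)
Definition same_measure {d} {T : measurableType d} {R : realType}
    (mu nu : set T -> \bar R) : Prop :=
  forall A, measurable A -> mu A = nu A.

(* Radon probability measures with finite p-moment; every Borel probability
   measure on R^n is Radon. *)
Record Pp (R : realType) (n : nat) (p : R) := MkPp {
  Pp_prob :> probability 'rV[R]_n R ;
  Pp_moment : (\int[Pp_prob]_x (enorm x `^ p)%:E < +oo)%E }.

(* W_p is defined by couplings, since it is needed on all of Pp; between
   absolutely continuous measures it is also the infimum over transport maps. *)
Section wasserstein.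
Context {R : realType} {n : nat} {p : R}.
Implicit Types mu nu : Pp n p.

Definition coupling mu nu : set (probability ('rV[R]_n * 'rV[R]_n)%type R) :=
  [set pi | forall A : set 'rV[R]_n, measurable A ->
     pi (fst @^-1` A) = mu A /\ pi (snd @^-1` A) = nu A].

Definition Wp mu nu : \bar R :=
  ((ereal_inf [set \int[pi]_z (enorm (z.1 - z.2) `^ p)%:E
               | pi in coupling mu nu]) `^ p^-1)%E.

(* The codomain C^1 /\ L^oo is the first clause together with the bound M. *)
Definition hypothesis_H (v : Pp n p -> 'rV[R]_n -> 'rV[R]_n) (L M K : R) :
    Prop :=
  [/\ forall mu, C1 (v mu),
      forall mu x y, enorm (v mu x - v mu y) <= L * enorm (x - y),
      forall mu x, enorm (v mu x) <= M &
      forall mu nu,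
        (C0norm (fun x => v mu x - v nu x)%R <= K%:E * Wp mu nu)%E].

Definition Pac_c mu : Prop := abs_continuous mu /\ compact (supp mu).

Definition continuous_curve (T : R) (mu : R -> Pp n p) : Prop :=
  forall t, t \in `[0, T] ->
    Wp (mu s) (mu t) @[s --> within `[0, T] (nbhs t)] --> 0%E.

End wasserstein.

Fixpoint Ck {R : realType} {V : normedModType R} (k : nat) (f : V -> R) :
    Prop :=
  if k is k'.+1 then
    (forall z, differentiable f z) /\ (forall u, Ck k' (fun z => 'D_u f z))
  else continuous f.

Section continuity_equation.
Context {R : realType} {n : nat} {p : R}.

(* C_c^oo((0,T) x R^n), each function being extended by 0 to R x R^n. *)
Definition test_function (T : R) (f : R * 'rV[R]_n -> R) : Prop :=
  [/\ forall k, Ck k f,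
      compact (closure [set z | f z != 0]) &
      closure [set z | f z != 0] `<=` [set z | 0 < z.1 < T]].

Definition dt (f : R * 'rV[R]_n -> R) (t : R) (x : 'rV[R]_n) : R :=
  'D_((1, 0) : R * 'rV[R]_n) f (t, x).

Definition gradx (f : R * 'rV[R]_n -> R) (t : R) (x : 'rV[R]_n) : 'rV[R]_n :=
  \row_(i < n) 'D_((0, delta_mx ord0 i) : R * 'rV[R]_n) f (t, x).

(* Only the values mu t with t in [0, T] matter. *)
Definition solution (v : Pp n p -> 'rV[R]_n -> 'rV[R]_n) (T : R)
    (mu0 : Pp n p) (mu : R -> Pp n p) : Prop :=
  [/\ forall t, t \in `[0, T] -> Pac_c (mu t),
      continuous_curve T mu,
      same_measure (mu 0) mu0 &
      forall f, test_function T f ->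
        (\int[lebesgue_measure]_(t in `[0%R, T])
           \int[mu t]_x (dt f t x + dotp (gradx f t x) (v (mu t) x))%:E)%E
        = 0%E].

End continuity_equation.

(* Main.v *)
(* The solutions are transported by the flows of their velocity fields. This is
   proved without differentiating the flow and without mollification: over a
   short time interval [a, b], let finitely many points y_k move with constant
   velocities close to the field; then a smooth indicator of the union of the
   balls B(y_k(t), r(t)), with radii growing just fast enough to compensate for
   the Lipschitz deviation of the field, is a test function with nonnegative
   material derivative, so that
     mu_a (U_k B(y_k(a), r(a))) <= mu_b (U_k B(y_k(b), r(b))).
   Iterating along an Euler scheme and letting the radii tend to 0 gives
   mu_0 (Phi^-1 C) <= mu_t C for every closed C, where Phi is the flow; for two
   probability measures this forces mu_t = Phi # mu_0.
   Pushing couplings of the initial data by the two flows, a discrete Gronwall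
   argument yields W_p(mu_t, nu_t) <= e^((L + K) t) W_p(mu_0, nu_0), and
   L + K <= max(2 L, 8 K) unless both constants are negative, in which case
   space is a point. *)
Require Import Defs.
From HB Require Import structures.
From mathcomp Require Import all_boot all_order all_algebra.
From mathcomp Require Import all_classical all_reals all_analysis.
From mathcomp Require Import measurable_realfun ring lra.

Set Implicit Arguments.
Unset Strict Implicit.
Unset Printing Implicit Defensive.

Import Order.TTheory GRing.Theory Num.Theory.
Import numFieldNormedType.Exports.

Local Open Scope classical_set_scope.
Local Open Scope ring_scope.

(** * Smooth functions *)

(** The classical argument tests the equation with compositions by the inverse flow, which are
    constant along characteristics. The field is only C^1 in space and continuous in time, so these
    are not smooth, hence the usual mollification. An inequality asks for less: a smooth function
    with nonnegative derivative along the field, and a growing ball around an approximate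
    characteristic absorbs every error into its radius. Two features make the passage to the limit
    possible. The union of balls is tested as a whole, so the loss is measured in radii only and is
    independent of the number of balls. And once the mesh is fine enough, the final radius is at
    most a fixed multiple of the initial one, so that arbitrarily fine nets can be used. Squared
    radii are tracked because the squared distance is smooth at the centre. In the rate [L + K], [L]
    is the separation of two trajectories of one field and [K] the gap between the two fields,
    itself controlled by the current distance. *)

Section smooth_functions.
Context {R : realType}.

(* [flat 0] is the usual flat function exp(-1/x); the family is closed under
   derivation up to linear combinations. *)
Definition flat (m : nat) (x : R) : R :=
  if 0 < x then x ^- m * expR (- x^-1) else 0.

Lemma flat_le0 m x : x <= 0 -> flat m x = 0.
Proof. by rewrite /flat leNgt => /negbTE ->. Qed.

Lemma flat_ge0 m x : 0 <= flat m x.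
Proof.
rewrite /flat; case: ifPn => // x0.
by rewrite mulr_ge0 ?expR_ge0// invr_ge0 exprn_ge0 ?ltW.
Qed.

(** One term of the exponential series bounds [expR x^-1] below by a multiple of [x^-1 ^+ m.+1].
    Linear decay at 0 is what differentiability at 0 requires. *)
Lemma flat_le m x : `|flat m x| <= (m.+1)`!%:R * `|x|.
Proof.
rewrite /flat; case: ifPn => x0; last by rewrite normr0 mulr_ge0.
rewrite !gtr0_norm ?mulr_gt0 ?expR_gt0 ?invr_gt0 ?exprn_gt0//.
have fp : 0 < (m.+1)`!%:R :> R by rewrite ltr0n fact_gt0.
have ix0 : 0 < x^-1 by rewrite invr_gt0.
have := expR_ge1Dxn m (ltW ix0); rewrite expRN => e.
have {}e : x^-1 ^+ m.+1 / (m.+1)`!%:R <= expR x^-1.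
  by apply: le_trans e; rewrite lerDr.
rewrite ler_pdivrMr ?expR_gt0//.
apply: (@le_trans _ _ ((m.+1)`!%:R * x * (x^-1 ^+ m.+1 / (m.+1)`!%:R))); last first.
  by rewrite ler_wpM2l// mulr_ge0 ?ltW.
rewrite le_eqVlt; apply/orP; left; apply/eqP.
by rewrite exprS exprVn; field; rewrite !gt_eqF// exprn_gt0.
Qed.

Lemma is_derive_flat m (x : R) :
  is_derive x (1 : R) (flat m) (flat m.+2 x - m%:R * flat m.+1 x).
Proof.
have [x0|x0|->] := ltgtP x 0.
- rewrite !flat_le0 ?ltW// mulr0 subr0.
  apply: (@near_eq_is_derive _ _ _ (cst 0)).
  by near=> y; rewrite flat_le0//; near: y; exact: lt_le_nbhsl.
- pose f (y : R) := (y ^+ m)^-1 * expR (- y^-1).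
  apply: (@near_eq_is_derive _ _ _ f).
    by near=> y; rewrite /f /flat ifT//; near: y; exact: lt_nbhsr.
  have xm0 : x ^+ m != 0 by rewrite expf_neq0 ?gt_eqF.
  have d1 : is_derive x 1 (fun y : R => (y ^+ m)^-1)
      (- (x ^+ m) ^- 2 *: (m%:R *: x ^+ m.-1 *: (1 : R))).
    have dX : is_derive x 1 (fun y : R => y ^+ m) (m%:R *: x ^+ m.-1 *: (1 : R)).
      by apply: DeriveDef; [exact: exprn_derivable|rewrite exp_derive].
    exact: is_deriveV.
  have d2 : is_derive x 1 (fun y : R => - y^-1) (- (- x ^- 2 *: 1)).
    by apply: is_deriveN; apply: is_deriveV; rewrite gt_eqF.
  have d3 : is_derive x 1 (fun y : R => expR (- y^-1))
      (expR (- x^-1) * - (- x ^- 2 *: 1)).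
    exact: (@is_derive1_comp _ expR (fun y : R => - y^-1)).
  apply: is_derive_eq.
  rewrite /flat x0 /f /GRing.scale /=.
  case: m f xm0 d1 => [|m] f xm0 d1.
    by rewrite !mul0r mulr0 !subr0 mulr0 addr0 expr0 invr1; ring.
  by rewrite /= !exprS; field; rewrite expf_neq0 gt_eqF.
- rewrite !flat_le0// mulr0 subr0.
  have : (fun h : R => h^-1 *: (flat m (h *: 1 + 0) - flat m 0)) @ 0^' --> (0 : R).
    apply/cvgr0Pnorm_le => e e0; near=> h.
    have h0 : h != 0 by near: h; exact: nbhs_dnbhs_neq.
    rewrite addr0 scaler1 (flat_le0 m (lexx 0))// subr0 normrZ normfV.
    rewrite ler_pdivrMl ?normr_gt0//.
    (* The difference quotient at 0 is the next member of the family, so [flat_le] makes it tend to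
       0. *)
    have -> : flat m h = h * flat m.+1 h.
      rewrite /flat; case: ifPn => hp; last by rewrite mulr0.
      by rewrite exprS; field; rewrite h0 expf_neq0.
    rewrite normrM ler_wpM2l//.
    apply: (le_trans (flat_le _ _)).
    rewrite -ler_pdivlMl ?ltr0n ?fact_gt0//.
    near: h; apply: dnbhs0_le.
    by rewrite mulr_gt0// invr_gt0 ltr0n fact_gt0.
  move=> cv; apply: DeriveDef; last exact: cvg_lim cv.
  by apply/cvg_ex; exists 0.
Unshelve. all: by end_near. Qed.

Lemma continuous_flat m : continuous (flat m).
Proof.
move=> x; apply: differentiable_continuous; apply/derivable1_diffP.
exact: (@ex_derive _ _ _ _ _ _ _ (is_derive_flat m x)).
Qed.

Context {V : normedModType R}.
Implicit Types f g : V -> R.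

Lemma continuousCk k f : Ck k f -> continuous f.
Proof.
by case: k => [//|k] [df _] x; exact: differentiable_continuous.
Qed.

Lemma CkS k f : Ck k.+1 f -> Ck k f.
Proof.
elim: k f => [|k IH] f; first by move=> /continuousCk.
by move=> [df Df]; split=> // u; apply: IH; exact: Df.
Qed.

Lemma Ck_cst k (c : R) : Ck k (cst c : V -> R).
Proof.
elim: k c => [|k IH] c; first exact: cst_continuous.
split=> // u; have -> : (fun z => 'D_u (cst c : V -> R) z) = cst 0.
  by apply/funext => z; exact: derive_cst.
exact: IH.
Qed.

Lemma CkD k f g : Ck k f -> Ck k g -> Ck k (f + g).
Proof.
elim: k f g => [|k IH] f g; first by move=> cf cg x; apply: continuousD; [exact: cf|exact: cg].
move=> [df Df] [dg Dg]; split=> [z|u]; first exact: differentiableD.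
have -> : (fun z => 'D_u (f + g) z) = (fun z => 'D_u f z) + (fun z => 'D_u g z).
  by apply/funext => z; rewrite deriveD//; exact: diff_derivable.
exact: (IH _ _ (Df u) (Dg u)).
Qed.

Lemma CkM k f g : Ck k f -> Ck k g -> Ck k (f * g).
Proof.
elim: k f g => [|k IH] f g; first by move=> cf cg x; apply: continuousM; [exact: cf|exact: cg].
move=> fk gk; have [fk' gk'] := (CkS fk, CkS gk).
move: fk gk => [df Df] [dg Dg]; split=> [z|u]; first exact: differentiableM.
have -> : (fun z => 'D_u (f * g) z) =
    f * (fun z => 'D_u g z) + g * (fun z => 'D_u f z).
  by apply/funext => z; rewrite deriveM//; exact: diff_derivable.
by apply: CkD; apply: IH => //; [exact: Dg|exact: Df].
Qed.

Lemma CkZ k (c : R) f : Ck k f -> Ck k (c \*: f).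
Proof. exact: (CkM (Ck_cst k c)). Qed.

Lemma CkB k f g : Ck k f -> Ck k g -> Ck k (f - g).
Proof.
move=> fk gk.
have -> : f - g = f + (-1) \*: g.
  by apply/funext => z; rewrite /GRing.scale_fun !fctE/= scaleN1r.
exact/CkD/CkZ.
Qed.

Lemma Ck_sum k n (f : 'I_n -> V -> R) :
  (forall i, Ck k (f i)) -> Ck k (\sum_i f i).
Proof.
by move=> fk; apply: big_ind => //; [exact: (Ck_cst k 0)|exact: CkD].
Qed.

Lemma Ck_linear k (f : {linear V -> R}) : continuous f -> Ck k f.
Proof.
case: k => [//|k] cf; split=> [z|u]; first exact: linear_differentiable.
have -> : (fun z => 'D_u f z) = cst (f u).
  by apply/funext => z; rewrite deriveE ?diff_lin//; exact: linear_differentiable.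
exact: Ck_cst.
Qed.

Lemma derive_flat_comp m f u z : differentiable f z ->
  'D_u (flat m \o f) z = (flat m.+2 (f z) - m%:R * flat m.+1 (f z)) * 'D_u f z.
Proof.
move=> df.
have dh : differentiable (flat m) (f z).
  by apply/derivable1_diffP; case: (is_derive_flat m (f z)).
rewrite !deriveE//; last exact: differentiable_comp.
rewrite diff_comp//= -[X in 'd _ _ X = _]mulr1 [LHS]linearZ/= mulrC.
congr (_ * _); rewrite -deriveE//.
by case: (is_derive_flat m (f z)).
Qed.

(** The induction on [k] runs over all [m] at once, since each derivation raises [m]. *)
Lemma Ck_flat k m f : Ck k f -> Ck k (flat m \o f).
Proof.
elim: k m f => [|k IH] m f.
  by move=> cf x; apply: continuous_comp; [exact: cf|exact: continuous_flat].
move=> fk; have fk' := CkS fk; case: fk => df Df; split=> [z|u].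
  apply: differentiable_comp => //.
  by apply/derivable1_diffP; case: (is_derive_flat m (f z)).
have -> : (fun z => 'D_u (flat m \o f) z) =
    ((flat m.+2 \o f) - m%:R \*: (flat m.+1 \o f)) * (fun z => 'D_u f z).
  by apply/funext => z; exact: derive_flat_comp.
by apply: CkM; [apply: CkB; [|apply: CkZ]; exact: IH|exact: Df].
Qed.

End smooth_functions.

(** * A smooth step function and its derivative *)

Section smooth_step.
Context {R : realType}.

Lemma le_flat0 : {homo @flat R 0 : x y / x <= y}.
Proof.
move=> x y xy; have [x0|x0] := leP x 0; first by rewrite flat_le0 ?flat_ge0.
have y0 := lt_le_trans x0 xy.
rewrite /flat x0 y0 !expr0 !invr1 !mul1r ler_expR lerN2.
by rewrite lef_pV2 ?posrE.
Qed.

Lemma flat_gt0 m (x : R) : 0 < x -> 0 < flat m x.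
Proof. by move=> x0; rewrite /flat x0 mulr_gt0 ?expR_gt0 ?invr_gt0 ?exprn_gt0. Qed.

(** [flat 2] is the derivative of [flat 0]; this bound is the source of the Lipschitz constant of
    [step]. *)
Lemma flat2_le (x : R) : flat 2 x <= 2.
Proof.
rewrite /flat; case: ifPn => // x0.
have ix0 : 0 < x^-1 by rewrite invr_gt0.
have := expR_ge1Dxn 1 (ltW ix0); rewrite expRN => e.
rewrite -exprVn ler_pdivrMr ?expR_gt0//.
have -> : x^-1 ^+ 2 = 2 * (x^-1 ^+ 2 / 2) by field; rewrite gt_eqF.
rewrite ler_wpM2l//; apply: le_trans e; by rewrite lerDr.
Qed.

(* Composing [flat 0] with itself gives a smooth function that is constant on
   both sides of [0, 1], without any quotient of functions. *)
Definition step (x : R) : R := (flat 0 (flat 0 1))^-1 * flat 0 (flat 0 1 - flat 0 x).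

(** Minus the derivative of [step], written as a product of nonnegative factors so that its sign is
    visible. *)
Definition dstep (x : R) : R :=
  (flat 0 (flat 0 1))^-1 * (flat 2 (flat 0 1 - flat 0 x) * flat 2 x).

Lemma step_le0 x : x <= 0 -> step x = 1.
Proof.
by move=> x0; rewrite /step (flat_le0 _ x0) subr0 mulVf// gt_eqF ?flat_gt0 ?flat_gt0.
Qed.

Lemma step_ge1 x : 1 <= x -> step x = 0.
Proof.
by move=> x1; rewrite /step (@flat_le0 _ _ (_ - _)) ?mulr0// subr_le0 le_flat0.
Qed.

Lemma step_ge0 x : 0 <= step x.
Proof. by rewrite mulr_ge0 ?flat_ge0// invr_ge0 flat_ge0. Qed.

Lemma step_nincr x y : x <= y -> step y <= step x.
Proof.
move=> xy; rewrite ler_wpM2l ?invr_ge0 ?flat_ge0// le_flat0//.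
by rewrite lerB// le_flat0.
Qed.

Lemma step_le1 x : step x <= 1.
Proof.
have [x0|x0] := leP x 0; first by rewrite step_le0.
by rewrite -(step_le0 (lexx 0)) step_nincr ?ltW.
Qed.

Lemma dstep_ge0 x : 0 <= dstep x.
Proof. by rewrite !mulr_ge0 ?flat_ge0// invr_ge0 flat_ge0. Qed.

Lemma dstep_ge1 x : 1 <= x -> dstep x = 0.
Proof.
move=> x1; rewrite /dstep (@flat_le0 _ _ (_ - _)) ?mul0r ?mulr0//.
by rewrite subr_le0 le_flat0.
Qed.

Lemma dstep_le0 x : x <= 0 -> dstep x = 0.
Proof. by move=> x0; rewrite /dstep (flat_le0 2 x0) !mulr0. Qed.

Lemma Ck_step (V : normedModType R) k (f : V -> R) : Ck k f -> Ck k (step \o f).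
Proof.
move=> fk.
exact: (CkZ _ (Ck_flat 0 (CkB (Ck_cst k (flat 0 1)) (Ck_flat 0 fk)))).
Qed.

Lemma derive_step_comp (V : normedModType R) (f : V -> R) u z :
  differentiable f z -> 'D_u (step \o f) z = - (dstep (f z) * 'D_u f z).
Proof.
move=> df.
have flat_d m (g : V -> R) : differentiable g z -> differentiable (flat m \o g) z.
  move=> dg; apply: differentiable_comp => //.
  by apply/derivable1_diffP; case: (is_derive_flat m (g z)).
pose h : V -> R := cst (flat 0 1) - (flat 0 \o f).
have dh : differentiable h z by apply: differentiableB => //; exact: flat_d.
have -> : step \o f = (flat 0 (flat 0 1))^-1 \*: (flat 0 \o h) by [].
rewrite [LHS](@deriveZ _ _ _ (flat 0 \o h)); last exact/diff_derivable/flat_d.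
rewrite derive_flat_comp// mul0r subr0 deriveB//; last exact/diff_derivable/flat_d.
rewrite derive_cst derive_flat_comp// mul0r subr0 sub0r.
by rewrite /dstep /h/= /GRing.scale/= !fctE/=; ring.
Qed.

Lemma is_derive_step (x : R) : is_derive x (1 : R) step (- dstep x).
Proof.
have d : differentiable step x.
  have c1 : Ck 1 (idfun : R -> R) by apply: Ck_linear => z; exact: cvg_id.
  by have [+ _] := Ck_step c1; exact.
apply: DeriveDef; first exact/diff_derivable.
by rewrite [LHS](@derive_step_comp R id)// derive_id mulr1.
Qed.

Lemma continuous_dstep : continuous dstep.
Proof.
have c1 : Ck 0 (idfun : R -> R) by apply: Ck_linear => z; exact: cvg_id.
have c2 := Ck_flat 2 (CkB (Ck_cst 0 (flat 0 1)) (Ck_flat 0 c1)).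
exact: (CkZ (flat 0 (flat 0 1))^-1 (CkM c2 (Ck_flat 2 c1))).
Qed.

Lemma continuous_step : continuous step.
Proof.
move=> x; apply: differentiable_continuous; apply/derivable1_diffP.
by case: (is_derive_step x).
Qed.

Lemma step_lipschitz : exists2 C : R, 0 <= C &
  forall x y, `|step x - step y| <= C * `|x - y|.
Proof.
exists ((flat 0 (flat 0 1))^-1 * (2 * 2)); first by rewrite mulr_ge0 ?invr_ge0 ?flat_ge0.
move=> x y; wlog xy : x y / x <= y.
  move=> wl; have [/wl//|/ltW /wl] := leP x y.
  by rewrite distrC (distrC x).
have [|c _ e] := @MVT_segment _ step (fun x => - dstep x) x y xy (fun z _ => is_derive_step z).
  exact/continuous_subspaceT/continuous_step.
rewrite distrC e normrM normrN (distrC x) ler_wpM2r//.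
rewrite ger0_norm ?dstep_ge0// ler_wpM2l ?invr_ge0 ?flat_ge0//.
by rewrite ler_pM ?flat_ge0 ?flat2_le.
Qed.

End smooth_step.

(** * Euclidean norm and Borel sets *)

Section euclidean_norm.
Context {R : realType} {n : nat}.
Implicit Types x y z : 'rV[R]_n.

Lemma dotpC x y : dotp x y = dotp y x.
Proof. by apply: eq_bigr => i _; rewrite mulrC. Qed.

Lemma dotpDl x y z : dotp (x + y) z = dotp x z + dotp y z.
Proof. by rewrite -big_split; apply: eq_bigr => i _; rewrite /= mxE mulrDl. Qed.

Lemma dotpZl a x y : dotp (a *: x) y = a * dotp x y.
Proof. by rewrite mulr_sumr; apply: eq_bigr => i _; rewrite mxE mulrA. Qed.

Lemma dotpDr x y z : dotp z (x + y) = dotp z x + dotp z y.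
Proof. by rewrite !(dotpC z) dotpDl. Qed.

Lemma dotpZr a x y : dotp x (a *: y) = a * dotp x y.
Proof. by rewrite !(dotpC x) dotpZl. Qed.

Lemma dotpNr x y : dotp x (- y) = - dotp x y.
Proof. by rewrite -scaleN1r dotpZr mulN1r. Qed.

Lemma dotpBr x y z : dotp z (x - y) = dotp z x - dotp z y.
Proof. by rewrite dotpDr dotpNr. Qed.

Lemma dotp_ge0 x : 0 <= dotp x x.
Proof. by apply: sumr_ge0 => i _; rewrite -expr2 sqr_ge0. Qed.

Lemma enorm_ge0 x : 0 <= enorm x.
Proof. exact: sqrtr_ge0. Qed.

Lemma sqr_enorm x : enorm x ^+ 2 = dotp x x.
Proof. by rewrite sqr_sqrtr ?dotp_ge0. Qed.

Lemma enorm0 : enorm (0 : 'rV[R]_n) = 0.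
Proof.
by rewrite /enorm /dotp big1 ?sqrtr0// => i _; rewrite mxE mul0r.
Qed.

Lemma enormZ a x : enorm (a *: x) = `|a| * enorm x.
Proof.
by rewrite /enorm dotpZl dotpZr mulrA -expr2 sqrtrM ?sqr_ge0// sqrtr_sqr.
Qed.

Lemma enormN x : enorm (- x) = enorm x.
Proof. by rewrite -scaleN1r enormZ normrN normr1 mul1r. Qed.

Lemma enormBC x y : enorm (x - y) = enorm (y - x).
Proof. by rewrite -enormN opprB. Qed.

Lemma coord_le_enorm x i : `|x ord0 i| <= enorm x.
Proof.
rewrite -sqrtr_sqr ler_wsqrtr// /dotp (bigD1 i)//= -expr2 lerDl.
by apply: sumr_ge0 => j _; rewrite -expr2 sqr_ge0.
Qed.

Lemma norm_le_enorm x : `|x| <= enorm x.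
Proof.
rewrite [leLHS]/Num.norm/=.
have [->|/mx_norm_neq0[[i j] ->]] := eqVneq (mx_norm x) 0.
  exact: enorm_ge0.
by rewrite (ord1 i); exact: coord_le_enorm.
Qed.

Lemma enorm_eq0 x : enorm x = 0 -> x = 0.
Proof.
move=> x0; apply/rowP => i; rewrite mxE; apply/eqP.
by rewrite -normr_le0 -x0; exact: coord_le_enorm.
Qed.

(** Cauchy-Schwarz, from the squared norm of [enorm y *: x - enorm x *: y]; the degenerate cases are
    separated in order to divide by the product of the norms. *)
Lemma dotp_le x y : dotp x y <= enorm x * enorm y.
Proof.
have [x0|x0] := eqVneq (enorm x) 0.
  rewrite x0 mul0r (enorm_eq0 x0) /dotp big1// => i _; by rewrite mxE mul0r.
have [y0|y0] := eqVneq (enorm y) 0.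
  rewrite y0 mulr0 (enorm_eq0 y0) /dotp big1// => i _; by rewrite mxE mulr0.
have xy0 : 0 < enorm x * enorm y by rewrite mulr_gt0// lt_neqAle eq_sym ?x0 ?y0 enorm_ge0.
have := dotp_ge0 (enorm y *: x - enorm x *: y).
rewrite dotpBr !(dotpC (_ - _)) !dotpBr !dotpZl !dotpZr -!sqr_enorm (dotpC y x) => h.
rewrite -(ler_pM2l xy0); nra.
Qed.

Lemma enormD x y : enorm (x + y) <= enorm x + enorm y.
Proof.
rewrite -(@ler_pXn2r _ 2)// ?nnegrE ?addr_ge0 ?enorm_ge0//.
rewrite sqr_enorm dotpDr !dotpDl (dotpC y x) sqrrD !sqr_enorm.
have := dotp_le x y; lra.
Qed.

Lemma enormB x y : enorm (x - y) <= enorm x + enorm y.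
Proof. by apply: le_trans (enormD _ _) _; rewrite enormN. Qed.

Lemma enorm_dist x y : `|enorm x - enorm y| <= enorm (x - y).
Proof.
have := enormD (x - y) y; have := enormD (y - x) x.
rewrite !subrK (enormBC y) => h1 h2.
by rewrite ler_norml; apply/andP; split; lra.
Qed.

Lemma coord_le_norm x i : `|x ord0 i| <= `|x|.
Proof.
rewrite [leRHS]/Num.norm/= mx_normE.
exact: (le_bigmax _ (fun i : 'I_1 * 'I_n => `|x i.1 i.2|%:nng) (ord0, i)).
Qed.

Lemma enorm_le_norm x : enorm x <= n%:R * `|x|.
Proof.
rewrite -(@ler_pXn2r _ 2)// ?nnegrE ?mulr_ge0 ?enorm_ge0// sqr_enorm.
apply: (@le_trans _ _ (\sum_(i < n) `|x| ^+ 2)).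
  apply: ler_sum => i _; rewrite -expr2 -real_normK ?num_real//.
  rewrite ler_pXn2r ?nnegrE//; exact: coord_le_norm.
rewrite sumr_const card_ord exprMn -[leLHS]mulr_natl ler_wpM2r ?sqr_ge0//.
by rewrite -natrX ler_nat; case: (n) => // k; rewrite expnS leq_pmulr// expn_gt0.
Qed.

Lemma continuous_enorm : continuous (@enorm R n).
Proof.
move=> x; apply/(@cvgrPdist_lt _ _ _ (nbhs x)) => e e0.
have e1 : 0 < n.+1%:R^-1 * e by rewrite mulr_gt0// invr_gt0 ltr0n.
apply: filterS (nbhsx_ballx x _ e1) => y; rewrite -ball_normE/= => xy.
apply: (le_lt_trans (enorm_dist _ _)); apply: (le_lt_trans (enorm_le_norm _)).
apply: (@le_lt_trans _ _ (n.+1%:R * `|x - y|)).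
  by rewrite ler_wpM2r// ler_nat.
by rewrite -ltr_pdivlMl ?ltr0n.
Qed.

Lemma continuous_enorm_comp (T : topologicalType) (f : T -> 'rV[R]_n) :
  continuous f -> continuous (fun t => enorm (f t)).
Proof.
by move=> cf t; apply: (@continuous_comp _ _ _ f (@enorm R n)); [exact: cf|exact: continuous_enorm].
Qed.

Lemma continuous_enorm_sub (c : 'rV[R]_n) : continuous (fun x => enorm (x - c)).
Proof.
apply: continuous_enorm_comp => x.
by apply: (@continuousB _ _ _ id (cst c)) => [?|]; last exact: cst_continuous.
Qed.

Lemma enorm_lipschitz_continuous (C : R) (f : 'rV[R]_n -> 'rV[R]_n) :
  (forall x y, enorm (f x - f y) <= C * enorm (x - y)) -> continuous f.
Proof.
move=> fC x; apply/(@cvgrPdist_lt _ _ _ (nbhs x)) => e e0.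
have : continuous (fun y => enorm (x - y)).
  apply: continuous_enorm_comp => z.
  by apply: (@continuousB _ _ _ (cst x) id); [exact: cst_continuous|move=> ?].
move=> /(_ x)/cvgrPdist_lt/(_ ((`|C| + 1)^-1 * e)); rewrite subrr enorm0.
rewrite mulr_gt0 ?invr_gt0 ?ltr_wpDl// => /(_ isT); apply: filterS => y.
rewrite sub0r normrN ger0_norm ?enorm_ge0// ltr_pdivlMl ?ltr_wpDl// => xy.
apply: (le_lt_trans (norm_le_enorm _)); apply: (le_lt_trans (fC _ _)).
apply: le_lt_trans xy.
by rewrite ler_wpM2r ?enorm_ge0// ler_wpDr// ler_norm.
Qed.

End euclidean_norm.

Section borel.
Context {R : realType} {n : nat}.

Lemma open_measurable_rV (A : set 'rV[R]_n) : open A -> measurable A.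
Proof. by move=> oA; exact: sub_sigma_algebra. Qed.

Lemma closed_measurable_rV (A : set 'rV[R]_n) : closed A -> measurable A.
Proof.
move=> cA; rewrite -(setCK A); apply: measurableC; apply: open_measurable_rV.
exact: closed_openC.
Qed.

Lemma continuous_measurable_rV (f : 'rV[R]_n -> R) :
  continuous f -> measurable_fun setT f.
Proof.
move=> /continuousP cf; apply: (measurability _ (RGenOpens.measurableE R)).
move=> _ [_ [a [b ->] <-]]; rewrite setTI; apply: open_measurable_rV.
exact/cf/interval_open.
Qed.

Lemma continuous_measurable_rV_rV m (f : 'rV[R]_n -> 'rV[R]_m) :
  continuous f -> measurable_fun setT f.
Proof.
move=> /continuousP cf; apply: (measurability (@open 'rV[R]_m)) => //.
by move=> _ [A oA <-]; rewrite setTI; apply: open_measurable_rV; exact: cf.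
Qed.

(** The source carries the product of two Borel sigma-algebras, so continuity on the product space
    does not directly give measurability; the expansion in coordinates does. *)
Lemma measurable_enorm_sub :
  measurable_fun [set: 'rV[R]_n * 'rV[R]_n] (fun z => enorm (z.1 - z.2)).
Proof.
have mc i : measurable_fun [set: 'rV[R]_n] (fun x => x ord0 i).
  by apply: continuous_measurable_rV; exact: coord_continuous.
rewrite (_ : (fun z => _) = fun z : 'rV[R]_n * 'rV[R]_n =>
    Num.sqrt (\sum_(i < n) (z.1 ord0 i - z.2 ord0 i) ^+ 2)); last first.
  by apply/funext => z; congr Num.sqrt; apply: eq_bigr => i _; rewrite !mxE expr2.
apply: (@measurableT_comp _ _ _ _ _ _ (@Num.sqrt R)).
  by apply: continuous_measurable_fun; exact: sqrt_continuous.
apply: measurable_sum => i; apply: measurable_funX; apply: measurable_funB.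
  exact: (measurableT_comp (mc i)).
exact: (measurableT_comp (mc i)).
Qed.

End borel.

Section monotone_integral.
Context d (T : measurableType d) (R : realType).
Variable mu : {measure set T -> \bar R}.
Local Open Scope ereal_scope.

(* No measurability is needed: the integral of a nonnegative function is a
   supremum over the simple functions below it. *)
Lemma le_integral_nomeas (D : set T) (f g : T -> \bar R) :
  (forall x, D x -> f x <= g x) -> \int[mu]_(x in D) f x <= \int[mu]_(x in D) g x.
Proof.
move=> fg; have {}fg x : (f \_ D) x <= (g \_ D) x.
  by rewrite !patchE; case: ifPn => // /set_mem /fg.
rewrite /integral; apply: leeB; apply: ereal_sup_le => _ [h hf <-]; exists h => //= x;
  apply: (le_trans (hf x)).
- by apply: (@funepos_le _ _ setT); rewrite ?inE.
- by apply: (@funeneg_le _ _ setT); rewrite ?inE.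
Qed.

End monotone_integral.

Section probability_integral.
Context d (T : measurableType d) (R : realType) (P : probability T R).

Lemma bounded_integrable (f : T -> R) (C : R) : measurable_fun setT f ->
  (forall x, `|f x| <= C) -> P.-integrable setT (EFin \o f).
Proof.
move=> mf fC; apply: measurable_bounded_integrable => //.
  by rewrite (le_lt_trans (probability_le1 _ _))// ltry.
by exists C; split; [exact: num_real|move=> y Cy x _; exact: (le_trans (fC x)) (ltW Cy)].
Qed.

Lemma probability_integral_cst (c : R) : (\int[P]_x c%:E = c%:E)%E.
Proof. by rewrite integral_cst// [X in (_ * X)%E]probability_setT mule1. Qed.

End probability_integral.

(** * Test functions following moving points *)

Section transported_bumps.
Context {R : realType} {n : nat}.
Notation V := (R * 'rV[R]_n)%type.
Implicit Types (z v : V) (x w : 'rV[R]_n).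

Lemma is_derive_affine (W : normedModType R) (f : W -> R) (z v : W) (l : R) :
  (forall h, f (h *: v + z) - f z = h * l) -> is_derive z v f l.
Proof.
move=> fl.
have cv : (fun h : R => h^-1 *: (f (h *: v + z) - f z)) @ 0^' --> l.
  apply: (@cvg_trans _ (cst l @ (0 : R)^')); last exact: cvg_cst.
  apply: near_eq_cvg; near=> h.
  rewrite fl /GRing.scale/= mulKf//; near: h; exact: nbhs_dnbhs_neq.
by apply: DeriveDef; [apply/cvg_ex; exists l|exact: cvg_lim cv].
Unshelve. all: by end_near. Qed.

Lemma Ck_time k : Ck k (fun z => z.1).
Proof. by apply: (@Ck_linear _ _ k (fst : {linear V -> R})) => z; exact: cvg_fst. Qed.

Lemma Ck_space k i : Ck k (fun z => z.2 ord0 i).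
Proof.
have lin : linear (fun z : V => z.2 ord0 i : R).
  by move=> a y z; rewrite !mxE.
pose f : {linear V -> R} :=
  HB.pack (fun z : V => z.2 ord0 i : R) (GRing.isLinear.Build _ _ _ _ _ lin).
apply: (@Ck_linear _ _ k f) => z.
apply: (@continuous_comp _ _ _ (snd : V -> 'rV[R]_n) (fun x => x ord0 i : R)).
  exact: cvg_snd.
exact: coord_continuous.
Qed.

(** Linearity of the differential turns the integrand of the weak formulation into one directional
    derivative, to which product and chain rules apply. *)
Lemma material_derivative (f : V -> R) t x w : differentiable f (t, x) ->
  dt f t x + dotp (gradx f t x) w = 'D_((1, w) : V) f (t, x).
Proof.
move=> df; rewrite /dt !deriveE//.
have -> : ((1, w) : V) =
    (1, 0) + \sum_(i < n) w ord0 i *: ((0, delta_mx ord0 i) : V).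
  have -> : \sum_(i < n) w ord0 i *: ((0, delta_mx ord0 i) : V) =
      (\sum_(i < n) w ord0 i *: (0 : R), \sum_(i < n) w ord0 i *: delta_mx ord0 i).
    by apply: (big_ind3 (fun (a : V) b c => a = (b, c))) => //= a b c d e f0 -> ->.
  rewrite big1 => [|i _]; last by rewrite scaler0.
  rewrite -row_sum_delta; congr pair; rewrite /=; [by rewrite addr0|by rewrite add0r].
rewrite linearD linear_sum/=; congr (_ + _); apply: eq_bigr => i _.
by rewrite linearZ/= mxE deriveE// mulrC.
Qed.

Variables (a r kappa theta : R).

Definition displacement (k : 'rV[R]_n * 'rV[R]_n) z : 'rV[R]_n :=
  z.2 - k.1 - (z.1 - a) *: k.2.

(* At most 0 on the ball of squared radius r^2 + kappa (t - a) around the point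
   moving with constant velocity k.2 from k.1 at time a, and at least 1 outside
   the ball whose squared radius is larger by theta. *)
Definition level (k : 'rV[R]_n * 'rV[R]_n) z : R :=
  theta^-1 * (dotp (displacement k z) (displacement k z)
              - (r ^+ 2 + kappa * (z.1 - a))).

Let comp (k : 'rV[R]_n * 'rV[R]_n) i : V -> R :=
  (fun z => z.2 ord0 i) - cst (k.1 ord0 i)
  - k.2 ord0 i \*: ((fun z => z.1) - cst a).

(** The point-free form is the one on which the closure properties of [Ck] and the derivation rules
    act. *)
Let levelE k : level k = theta^-1 \*:
  (\sum_(i < n) (comp k i * comp k i)
   - (cst (r ^+ 2) + kappa \*: ((fun z => z.1) - cst a))).
Proof.
apply/funext => z; rewrite /level /GRing.scale_fun !fctE; congr (_ * (_ - _)).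
rewrite fct_sumE; apply: eq_bigr => i _.
by rewrite /comp /displacement/= !fctE/= !mxE /GRing.scale/= !(mulrC (k.2 _ _)).
Qed.

Lemma Ck_level k l : Ck k (level l).
Proof.
rewrite levelE; have t1 := CkB (Ck_time k) (Ck_cst k a).
apply: CkZ; apply: CkB; last by apply: CkD (Ck_cst _ _) _; exact: CkZ.
have ck i : Ck k (comp l i).
  by apply: CkB; [apply: CkB; [exact: Ck_space|exact: Ck_cst]|exact: CkZ].
by apply: Ck_sum => i; exact: CkM.
Qed.

Lemma derive_level k z w : 'D_((1, w) : V) (level k) z =
  theta^-1 * (2 * dotp (displacement k z) (w - k.2) - kappa).
Proof.
have dcomp i : is_derive z ((1, w) : V) (comp k i) (w ord0 i - k.2 ord0 i).
  apply: is_derive_affine => h.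
  by rewrite /comp /GRing.scale_fun/= !fctE/= /GRing.scale/= !mxE; ring.
have dtime : is_derive z ((1, w) : V) (cst (r ^+ 2) + kappa \*: ((fun z => z.1) - cst a)) kappa.
  apply: is_derive_affine => h.
  by rewrite /GRing.scale_fun/= !fctE/= /GRing.scale/=; ring.
have dsum : is_derive z ((1, w) : V) (\sum_(i < n) (comp k i * comp k i))
    (2 * dotp (displacement k z) (w - k.2)).
  have dsq i : is_derive z ((1, w) : V) (comp k i * comp k i)
      (2 * (displacement k z ord0 i * (w - k.2) ord0 i)).
    apply: is_derive_eq; rewrite /comp /displacement /GRing.scale_fun/= !fctE/=.
    by rewrite /GRing.scale/= !mxE; ring.
  rewrite /dotp mulr_sumr; exact: is_derive_sum.
rewrite levelE.
by have [_ ->] := is_deriveZ theta^-1 (is_deriveB dsum dtime).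
Qed.

End transported_bumps.

Section bump_products.
Context {R : realType} {n : nat}.
Notation V := (R * 'rV[R]_n)%type.
Implicit Types (z : V) (x w : 'rV[R]_n) (s : seq ('rV[R]_n * 'rV[R]_n)).
Variables (a b r rmax kappa theta : R).
Hypotheses (theta0 : 0 < theta) (kappa0 : 0 <= kappa) (rmax0 : 0 <= rmax).
Hypothesis rmaxE : r ^+ 2 + kappa * (b - a) + theta <= rmax ^+ 2.

Let lev := @level R n a r kappa theta.

(* [1 - avoid s] is a smooth indicator of a union of moving balls. *)
Fixpoint avoid s : V -> R :=
  if s is k :: s' then (cst 1 - (step \o lev k)) * avoid s' else cst 1.

Lemma Ck_avoid k s : Ck k (avoid s).
Proof.
elim: s => [|c s IH]; first exact: Ck_cst.
by apply: CkM => //; apply: CkB; [exact: Ck_cst|apply/Ck_step/Ck_level].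
Qed.

Lemma avoid_ge0_le1 s z : 0 <= avoid s z <= 1.
Proof.
elim: s => [|c s /andP[IH0 IH1]]; first by rewrite /= ler01 lexx.
have [g0 g1] := (step_ge0 (lev c z), step_le1 (lev c z)).
rewrite /avoid -/avoid !fctE/=; apply/andP; split.
  by rewrite mulr_ge0// subr_ge0.
by rewrite -[leRHS]mulr1 ler_pM// ?subr_ge0// lerBlDr lerDl.
Qed.

Lemma displacementE c t x : displacement a c (t, x) = x - (c.1 + (t - a) *: c.2).
Proof. by rewrite /displacement/= opprD addrA. Qed.

(** The radius [rmax] serves all times of [a, b] at once: by [rmaxE], its square dominates the
    growing squared radius together with the transition layer [theta]. *)
Lemma level_ge1 c t x : a <= t <= b ->
  rmax <= enorm (x - (c.1 + (t - a) *: c.2)) -> 1 <= lev c (t, x).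
Proof.
move=> /andP[at_ tb] h; rewrite /lev /level displacementE -sqr_enorm/=.
rewrite ler_pdivlMl// mulr1.
have : rmax ^+ 2 <= enorm (x - (c.1 + (t - a) *: c.2)) ^+ 2.
  by rewrite ler_pXn2r// ?nnegrE ?enorm_ge0.
have : kappa * (t - a) <= kappa * (b - a) by rewrite ler_wpM2l// lerB.
move: rmaxE; lra.
Qed.

Lemma level_le0 c x : 0 <= r -> enorm (x - c.1) <= r -> lev c (a, x) <= 0.
Proof.
move=> r0 h; rewrite /lev /level displacementE -sqr_enorm/= subrr scale0r addr0.
rewrite mulr0 addr0 pmulr_rle0 ?invr_gt0// subr_le0.
by rewrite ler_pXn2r// nnegrE ?enorm_ge0.
Qed.

Lemma avoid_far s t x : a <= t <= b ->
  {in s, forall c, rmax <= enorm (x - (c.1 + (t - a) *: c.2))} ->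
  avoid s (t, x) = 1.
Proof.
move=> tab; elim: s => [//|c s IH] h.
rewrite /avoid -/avoid !fctE/= IH => [|k ks]; last by rewrite h// inE ks orbT.
by rewrite step_ge1 ?subr0 ?mulr1// level_ge1// h// mem_head.
Qed.

Lemma avoid_near s c x : 0 <= r -> c \in s -> enorm (x - c.1) <= r ->
  avoid s (a, x) = 0.
Proof.
move=> r0 + h; elim: s => [//|k s IH]; rewrite inE /avoid -/avoid !fctE/=.
move=> /orP[/eqP <-|/IH ->]; last by rewrite mulr0.
by rewrite step_le0 ?subrr ?mul0r// level_le0.
Qed.

(* [dstep] vanishes outside the balls of radius [rmax]; inside them, the radii
   grow fast enough to compensate for the relative velocity. *)
Lemma derive_avoid_le0 (L D : R) s t x w : 0 <= L -> 0 <= D -> a <= t <= b ->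
  kappa = 2 * rmax * (L * rmax + D) ->
  {in s, forall c,
    enorm (w - c.2) <= L * enorm (x - (c.1 + (t - a) *: c.2)) + D} ->
  'D_((1, w) : V) (avoid s) (t, x) <= 0.
Proof.
move=> L0 D0 tab kE; elim: s => [_|c s IH h]; first by rewrite derive_cst.
have dl : differentiable (lev c) (t, x) by have [+ _] := Ck_level a r kappa theta 1 c.
have ds k : differentiable (step \o lev k) (t, x).
  by have [+ _] := Ck_step (Ck_level a r kappa theta 1 k).
have da k : differentiable (avoid k) (t, x) by have [+ _] := Ck_avoid 1 k.
rewrite /avoid -/avoid deriveM; last 2 first.
- by apply: diff_derivable; apply: differentiableB => //.
- by apply: diff_derivable; exact: da.
rewrite deriveB//; last by apply: diff_derivable; exact: ds.
rewrite derive_cst derive_step_comp// sub0r opprK.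
have {}IH : 'D_((1, w) : V) (avoid s) (t, x) <= 0.
  by apply: IH => k ks; rewrite h// inE ks orbT.
have [/andP[a0 _] s1] := (avoid_ge0_le1 s (t, x), step_le1 (lev c (t, x))).
suff d0 : dstep (lev c (t, x)) * 'D_((1, w) : V) (lev c) (t, x) <= 0.
  rewrite !fctE/= /GRing.scale/= -[leRHS]addr0 lerD//.
    by rewrite mulr_ge0_le0// subr_ge0.
  by rewrite mulr_ge0_le0.
have [far|near] := leP rmax (enorm (x - (c.1 + (t - a) *: c.2))).
  by rewrite dstep_ge1 ?mul0r// level_ge1.
rewrite mulr_ge0_le0 ?dstep_ge0// derive_level pmulr_rle0 ?invr_gt0// subr_le0.
rewrite displacementE kE; set e := enorm _ in near.
have e0 : 0 <= e := enorm_ge0 _.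
have := dotp_le (x - (c.1 + (t - a) *: c.2)) (w - c.2); rewrite -/e => le1.
have le2 := h c (mem_head _ _); rewrite -/e in le2.
have le3 : e * enorm (w - c.2) <= rmax * (L * rmax + D).
  apply: ler_pM => //; [exact: enorm_ge0|exact: ltW|apply: (le_trans le2)].
  by rewrite lerD2r ler_wpM2l// ltW.
by rewrite -mulrA ler_wpM2l//; exact: le_trans le3.
Qed.

(** [level] is quadratic in [x], hence only locally Lipschitz. Cutting the distance off at [rmax]
    leaves [step] of it unchanged, since [step] already vanishes there, and gives a global
    constant. *)
Lemma step_level_lipschitz c : 0 <= b - a -> exists2 C : R, 0 <= C &
  forall t t' x x', a <= t <= b -> a <= t' <= b ->
  `|step (lev c (t, x)) - step (lev c (t', x'))| <= C * (`|t - t'| + enorm (x - x')).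
Proof.
move=> ab; have [C C0 sC] := @step_lipschitz R.
pose e t x := Num.min (enorm (x - (c.1 + (t - a) *: c.2))) rmax.
pose N := theta^-1 * (2 * rmax * (1 + enorm c.2) + kappa).
have N0 : 0 <= N.
  apply: mulr_ge0; first by rewrite invr_ge0 ltW.
  by rewrite addr_ge0// !mulr_ge0// addr_ge0// enorm_ge0.
exists (C * N); first exact: mulr_ge0.
have red t x : a <= t <= b -> step (lev c (t, x)) =
    step (theta^-1 * (e t x ^+ 2 - (r ^+ 2 + kappa * (t - a)))).
  move=> tab; rewrite /e /Num.min; case: ltP => h.
    by rewrite /lev /level displacementE -sqr_enorm.
  rewrite step_ge1 ?level_ge1// step_ge1// ler_pdivlMl// mulr1.
  have : kappa * (t - a) <= kappa * (b - a).
    by case/andP: tab => _ tb; rewrite ler_wpM2l// lerB.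
  by move: rmaxE; lra.
move=> t t' x x' tab tab'; rewrite !red//.
apply: (le_trans (sC _ _)); rewrite -mulrA ler_wpM2l//.
rewrite -mulrBr normrM gtr0_norm ?invr_gt0// -mulrA.
rewrite ler_wpM2l ?(ltW (_ : 0 < theta^-1)) ?invr_gt0//.
have e0 (s : R) y : 0 <= e s y by rewrite /e le_min enorm_ge0.
have e1 (s : R) y : e s y <= rmax by rewrite /e ge_min lexx orbT.
have le1 : `|e t x - e t' x'| <= enorm (x - x') + `|t - t'| * enorm c.2.
  have : `|enorm (x - (c.1 + (t - a) *: c.2)) - enorm (x' - (c.1 + (t' - a) *: c.2))|
      <= enorm (x - x') + `|t - t'| * enorm c.2.
    apply: (le_trans (enorm_dist _ _)); rewrite -enormZ.
    apply: le_trans (enormB _ _); rewrite le_eqVlt; apply/orP; left; apply/eqP.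
    by congr enorm; apply/rowP => i; rewrite !mxE; ring.
  rewrite !ler_norml /e /Num.min => /andP[h1 h2].
  have [d0 n0] := (enorm_ge0 (x - x'), mulr_ge0 (normr_ge0 (t - t')) (enorm_ge0 c.2)).
  by do 2 (case: ltP => ?); apply/andP; split; lra.
have -> : e t x ^+ 2 - (r ^+ 2 + kappa * (t - a)) -
    (e t' x' ^+ 2 - (r ^+ 2 + kappa * (t' - a))) =
    (e t x - e t' x') * (e t x + e t' x') - kappa * (t - t') by ring.
apply: (le_trans (ler_normB _ _)); rewrite !normrM (ger0_norm kappa0).
rewrite (ger0_norm (addr_ge0 (e0 t x) (e0 t' x'))).
have le2 : `|e t x - e t' x'| * (e t x + e t' x') <=
    (enorm (x - x') + `|t - t'| * enorm c.2) * (rmax + rmax).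
  by rewrite ler_pM ?addr_ge0// lerD.
have d0 := enorm_ge0 (x - x'); have t0 := normr_ge0 (t - t').
have := mulr_ge0 rmax0 t0; have := mulr_ge0 rmax0 (mulr_ge0 d0 (enorm_ge0 c.2)).
have := mulr_ge0 kappa0 d0; move: le2; lra.
Qed.

Lemma avoid_lipschitz s : 0 <= b - a -> exists2 C : R, 0 <= C &
  forall t t' x x', a <= t <= b -> a <= t' <= b ->
  `|avoid s (t, x) - avoid s (t', x')| <= C * (`|t - t'| + enorm (x - x')).
Proof.
move=> ab; elim: s => [|c s [C C0 IH]].
  by exists 0 => // t t' x x' _ _; rewrite mul0r /avoid/= subrr normr0.
have [D D0 sD] := step_level_lipschitz c ab.
exists (D + C); first exact: addr_ge0.
move=> t t' x x' tab tab'; rewrite /avoid -/avoid !fctE/=.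
set u := step _; set u' := step _; set v := avoid s _; set v' := avoid s _.
have -> : (1 - u) * v - (1 - u') * v' = (1 - u) * (v - v') - (u - u') * v' by ring.
apply: (le_trans (ler_normB _ _)); rewrite !normrM addrC mulrDl lerD//.
  rewrite -[leRHS]mulr1 ler_pM//; first exact: sD.
  by have /andP[v0 v1] := avoid_ge0_le1 s (t', x'); rewrite ger0_norm.
rewrite -[leRHS]mul1r ler_pM//; last exact: IH.
by rewrite ger0_norm ?subr_ge0 ?step_le1// lerBlDr lerDl step_ge0.
Qed.

End bump_products.

(** * Estimates for the Wasserstein distance *)

Section wasserstein_estimates.
Context {R : realType} {n : nat} {p : R}.
Hypothesis p1 : 1 <= p.
Implicit Types m : Pp n p.

Lemma measurable_cost : measurable_fun [set: 'rV[R]_n * 'rV[R]_n]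
  (fun z => (enorm (z.1 - z.2) `^ p)%:E).
Proof.
apply/measurable_EFinP; apply: (@measurableT_comp _ _ _ _ _ _ (@powR R ^~ p)) => //.
exact: measurable_enorm_sub.
Qed.

Lemma le_poweR (x y : \bar R) (s : R) : 0 <= s -> (0 <= x)%E -> (x <= y)%E ->
  (x `^ s <= y `^ s)%E.
Proof.
move=> s0 x0 xy; apply: gt0_ler_poweR => //; rewrite in_itv/= leey andbT//.
exact: le_trans xy.
Qed.

Lemma Wp_ge0 m1 m2 : (0 <= Wp m1 m2)%E.
Proof. exact: poweR_ge0. Qed.

Lemma Wp_le m1 m2 pi (D : R) : 0 <= D -> coupling m1 m2 pi ->
  (\int[pi]_z (enorm (z.1 - z.2) `^ p)%:E <= (D `^ p)%:E)%E ->
  (Wp m1 m2 <= D%:E)%E.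
Proof.
have p0 : 0 < p by rewrite (lt_le_trans _ p1).
move=> D0 cpi piD; have -> : D%:E = ((D `^ p)%:E `^ p^-1)%E.
  by rewrite poweR_EFin -powRrM divff ?gt_eqF// powRr1.
apply: le_poweR; first by rewrite invr_ge0 ltW.
  apply: le_ereal_inf_tmp => _ [pi' _ <-].
  by apply: integral_ge0 => z _; rewrite lee_fin powR_ge0.
by apply: ge_ereal_inf; eexists; [exists pi; [exact: cpi|]|exact: piD].
Qed.

(** The strict inequality replaces the existence of an optimal coupling. *)
Lemma Wp_lt_coupling m1 m2 (D : R) : (Wp m1 m2 < D%:E)%E ->
  exists2 pi, coupling m1 m2 pi &
    (\int[pi]_z (enorm (z.1 - z.2) `^ p)%:E <= (D `^ p)%:E)%E.
Proof.
have p0 : 0 < p by rewrite (lt_le_trans _ p1).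
move=> WD; have D0 : 0 <= D.
  by rewrite -lee_fin (le_trans _ (ltW WD))// Wp_ge0.
have [/ereal_inf_lt[_ [pi cpi <-] piD]|] := ltP
    (ereal_inf [set \int[pi]_z (enorm (z.1 - z.2) `^ p)%:E | pi in coupling m1 m2])%E
    (D `^ p)%:E.
  by exists pi => //; exact: ltW.
move=> h; exfalso; move: WD; rewrite ltNge => /negP; apply.
have -> : D%:E = ((D `^ p)%:E `^ p^-1)%E.
  by rewrite poweR_EFin -powRrM divff ?gt_eqF// powRr1.
by apply: le_poweR => //; [rewrite invr_ge0 ltW|rewrite lee_fin powR_ge0].
Qed.

Lemma coupling_integral m1 m2 pi (f g : 'rV[R]_n -> R) (C : R) :
  coupling m1 m2 pi -> measurable_fun setT f -> measurable_fun setT g ->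
  (forall x, `|f x| <= C) -> (forall x, `|g x| <= C) ->
  (\int[m1]_x (f x)%:E - \int[m2]_x (g x)%:E =
   \int[pi]_z (f z.1 - g z.2)%:E)%E.
Proof.
move=> cpi mf mg fC gC.
have if1 := bounded_integrable pi (measurableT_comp mf measurable_fst) (fun z => fC z.1).
have ig2 := bounded_integrable pi (measurableT_comp mg measurable_snd) (fun z => gC z.2).
have -> : (\int[m1]_x (f x)%:E = \int[pi]_z (f z.1)%:E)%E.
  rewrite (eq_measure_integral (pushforward pi fst)); last first.
    by move=> A mA _; exact: esym (cpi A mA).1.
  rewrite integral_pushforward//; exact/measurable_EFinP.
have -> : (\int[m2]_x (g x)%:E = \int[pi]_z (g z.2)%:E)%E.
  rewrite (eq_measure_integral (pushforward pi snd)); last first.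
    by move=> A mA _; exact: esym (cpi A mA).2.
  rewrite integral_pushforward//; exact/measurable_EFinP.
by rewrite -integralB_EFin.
Qed.

(** Takes the place of Hölder's inequality when an integral of the distance is bounded by one of its
    [p]-th power: beyond [e], the factor [d / e] to the power [p - 1] is at least 1. *)
Lemma le_cost (d e : R) : 0 <= d -> 0 < e -> d <= e + e `^ (1 - p) * d `^ p.
Proof.
move=> d0 e0; have [de|ed] := leP d e.
  by rewrite ler_wpDr// mulr_ge0 ?powR_ge0.
apply: (@le_trans _ _ (e `^ (1 - p) * d `^ p)); last by rewrite lerDr ltW.
rewrite -[leLHS]mul1r.
have d1 := lt_trans e0 ed.
have -> : d `^ p = d `^ (p - 1) * d.
  by rewrite mulrC mulr_powRB1// (lt_le_trans _ p1).
rewrite mulrA ler_wpM2r//.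
have -> : e `^ (1 - p) = (e `^ (p - 1))^-1 by rewrite -powRN opprB.
rewrite ler_pdivlMl ?powR_gt0// mulr1; apply: ge0_ler_powR; rewrite ?nnegrE ?subr_ge0// ltW//.
Qed.

(** The constant [c] allows [f] and [g] to be one time-dependent function at two times, with [c] the
    time gap. *)
Lemma mean_diff_le m1 m2 (f g : 'rV[R]_n -> R) (C c D e B : R) :
  0 <= C -> 0 < e -> (Wp m1 m2 < D%:E)%E ->
  measurable_fun setT f -> measurable_fun setT g ->
  (forall x, `|f x| <= B) -> (forall x, `|g x| <= B) ->
  (forall x y, f x - g y <= C * (c + enorm (x - y))) ->
  (\int[m1]_x (f x)%:E - \int[m2]_x (g x)%:E <=
     (C * (c + e + e `^ (1 - p) * D `^ p))%:E)%E.
Proof.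
move=> C0 e0 /Wp_lt_coupling[pi cpi piD] mf mg fB gB fg.
rewrite (coupling_integral cpi mf mg fB gB).
have i0 : pi.-integrable setT (cst (C * (c + e))%:E).
  exact: (@bounded_integrable _ _ _ pi (cst (C * (c + e))) `|C * (c + e)|).
have i1 : pi.-integrable setT (fun z => (enorm (z.1 - z.2) `^ p)%:E).
  apply/integrableP; split; first exact: measurable_cost.
  under eq_integral do rewrite gee0_abs ?lee_fin ?powR_ge0//.
  by rewrite (le_lt_trans piD)// ltry.
pose k := C * e `^ (1 - p).
have k0 : 0 <= k by rewrite mulr_ge0 ?powR_ge0.
apply: (@le_trans _ _ (\int[pi]_z
    ((C * (c + e))%:E + k%:E * (enorm (z.1 - z.2) `^ p)%:E))%E).
  apply: le_integral_nomeas => z _; rewrite -EFinM -EFinD lee_fin.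
  apply: (le_trans (fg _ _)); rewrite -mulrA -mulrDr ler_wpM2l// -addrA lerD2l.
  exact: le_cost (enorm_ge0 _) e0.
rewrite integralD//; last exact: integrableZl.
rewrite probability_integral_cst integralZl//.
rewrite (mulrDr C (c + e)) EFinD leeD2l// mulrA -/k.
rewrite [leRHS](EFinM k).
by apply: lee_wpmul2l; rewrite ?lee_fin.
Qed.

End wasserstein_estimates.

Section means_along_curve.
Context {R : realType} {n : nat} {p : R}.
Hypothesis p1 : 1 <= p.
Implicit Types m : Pp n p.

Definition mean (m : probability 'rV[R]_n R) (f : 'rV[R]_n -> R) : R :=
  fine (\int[m]_x (f x)%:E).

Lemma meanE (m : probability 'rV[R]_n R) (f : 'rV[R]_n -> R) (B : R) : measurable_fun setT f ->
  (forall x, `|f x| <= B) -> (mean m f)%:E = (\int[m]_x (f x)%:E)%E.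
Proof.
by move=> mf fB; rewrite fineK//; exact/integrable_fin_num/(bounded_integrable m mf fB).
Qed.

Lemma mean_dist_le m1 m2 (f g : 'rV[R]_n -> R) (C c D e B : R) :
  0 <= C -> 0 < e -> (Wp m1 m2 < D%:E)%E ->
  measurable_fun setT f -> measurable_fun setT g ->
  (forall x, `|f x| <= B) -> (forall x, `|g x| <= B) ->
  (forall x y, `|f x - g y| <= C * (c + enorm (x - y))) ->
  `|mean m1 f - mean m2 g| <= C * (c + e + e `^ (1 - p) * D `^ p).
Proof.
move=> C0 e0 W mf mg fB gB fg.
have H1 : mean m1 f - mean m2 g <= C * (c + e + e `^ (1 - p) * D `^ p).
  rewrite -lee_fin EFinB (meanE m1 mf fB) (meanE m2 mg gB).
  apply: (mean_diff_le p1 C0 e0 W mf mg fB gB) => x y.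
  by apply: le_trans (fg x y); rewrite ler_norm.
have opp m (h : 'rV[R]_n -> R) : measurable_fun setT h -> (forall x, `|h x| <= B) ->
    (\int[m]_x (- h x)%:E = - \int[m]_x (h x)%:E)%E.
  move=> mh hB; under eq_integral do rewrite EFinN.
  by rewrite integralN// integrable_add_def//; exact: (bounded_integrable m mh hB).
have H2 : mean m2 g - mean m1 f <= C * (c + e + e `^ (1 - p) * D `^ p).
  have fB' x : `|- f x| <= B by rewrite normrN.
  have gB' x : `|- g x| <= B by rewrite normrN.
  have h x y : - f x - (- g y) <= C * (c + enorm (x - y)).
    by apply: le_trans (fg x y); rewrite -normrN opprB opprK addrC ler_norm.
  have := mean_diff_le p1 C0 e0 W (measurable_funN mf) (measurable_funN mg) fB' gB' h.
  rewrite !opp// -(meanE m1 mf fB) -(meanE m2 mg gB) oppeK.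
  by rewrite -EFinN -EFinD lee_fin addrC.
by rewrite ler_norml H1 andbT lerNl opprB.
Qed.

Lemma continuous_curveP (T : R) (mu : R -> Pp n p) t : continuous_curve T mu ->
  t \in `[0, T] -> forall D, 0 < D -> exists2 d, 0 < d &
  forall s, s \in `[0, T] -> `|s - t| < d -> (Wp (mu s) (mu t) < D%:E)%E.
Proof.
move=> cmu tT D D0; have := cmu t tT.
have o : nbhs (0 : \bar R)%E [set x | (x < D%:E)%E].
  by apply: open_nbhs_nbhs; split; [exact: open_ereal_lt_ereal|rewrite /= lte_fin].
move=> /(_ _ o) /nbhs_ballP[d /= d0 h]; exists d => // s sT st.
by apply: (h s); rewrite //= /ball/= distrC.
Qed.

Lemma mean_continuous (T : R) (mu : R -> Pp n p) a b C (G : R -> 'rV[R]_n -> R) t0 :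
  continuous_curve T mu -> 0 <= a -> b <= T -> a <= t0 <= b -> 0 <= C ->
  (forall t, measurable_fun setT (G t)) -> (forall t x, `|G t x| <= 1) ->
  (forall t t' x x', a <= t <= b -> a <= t' <= b ->
    `|G t x - G t' x'| <= C * (`|t - t'| + enorm (x - x'))) ->
  forall e, 0 < e -> exists2 d, 0 < d & forall t, a <= t <= b -> `|t - t0| < d ->
    `|mean (mu t) (G t) - mean (mu t0) (G t0)| <= e.
Proof.
move=> cmu a0 bT t0ab C0 mG G1 GC e e0.
have inT t : a <= t <= b -> t \in `[0, T].
  by move=> /andP[at_ tb]; rewrite in_itv/= (le_trans a0 at_) (le_trans tb bT).
(* Three errors of size [e'] are added: the time gap, the threshold of [le_cost], and
   [e' ^ (1 - p) * e' ^ p], obtained with [D = e']. The constant [C + 1] is positive even if [C] is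
   0. *)
pose k := (C + 1) * 3; have k0 : 0 < k by rewrite mulr_gt0// ltr_wpDl.
pose e' := e / k; have e'0 : 0 < e' by rewrite divr_gt0.
have [d d0 hd] := continuous_curveP cmu (inT _ t0ab) e'0.
exists (Num.min d e'); first by rewrite lt_min d0.
move=> t tab; rewrite lt_min => /andP[td te].
have W := hd t (inT t tab) td.
apply: (le_trans (mean_dist_le C0 e'0 W (mG t) (mG t0) (G1 t) (G1 t0)
  (fun x y => GC t t0 x y tab t0ab))).
have -> : e' `^ (1 - p) * e' `^ p = e'.
  rewrite -powRD; last by rewrite (gt_eqF e'0) implybT.
  by rewrite subrK powRr1// ltW.
have -> : e = (C + 1) * (e' + e' + e') by rewrite /e' /k; field; rewrite gt_eqF// ltr_wpDl.
apply: ler_pM => //; rewrite ?lerDl// ?lerD ?(ltW te)//.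
by rewrite !addr_ge0// ltW.
Qed.

End means_along_curve.

(** * Growth of balls along a solution *)

Section balls_and_ramps.
Context {R : realType} {n : nat}.
Notation V := (R * 'rV[R]_n)%type.

Definition balls (cs : seq 'rV[R]_n) (r : R) : set 'rV[R]_n :=
  [set x | has (fun c => enorm (x - c) <= r) cs].

Lemma closed_enorm_ball (c : 'rV[R]_n) r : closed [set x | enorm (x - c) <= r].
Proof.
have cf := @continuous_enorm_sub R n c.
exact: (closed_comp (fun x _ => cf x) (@closed_le R r)).
Qed.

Lemma measurable_balls cs r : measurable (balls cs r).
Proof.
elim: cs => [|c cs IH].
  by rewrite (_ : balls _ _ = set0)//; apply/seteqP; split => // x.
rewrite (_ : balls _ _ = [set x | enorm (x - c) <= r] `|` balls cs r); last first.
  by apply/seteqP; split => x /=; [move=> /orP|move=> ?; apply/orP].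
by apply: measurableU => //; apply: closed_measurable_rV; exact: closed_enorm_ball.
Qed.

Lemma compact_enorm_ball r : compact [set x : 'rV[R]_n | enorm x <= r].
Proof.
apply: bounded_closed_compact.
  exists r; split; first exact: num_real.
  by move=> y ry x /= xr; rewrite (le_trans (norm_le_enorm x))// (le_trans xr)// ltW.
have := @closed_enorm_ball 0 r.
rewrite (_ : [set x | _] = [set x : 'rV[R]_n | enorm x <= r])//.
by apply/seteqP; split => x /=; rewrite subr0.
Qed.

Lemma seq_bound (A : eqType) (s : seq A) (f : A -> R) :
  exists B, {in s, forall c, f c <= B}.
Proof.
elim: s => [|c s [B h]]; first by exists 0.
exists (Num.max (f c) B) => k; rewrite inE => /orP[/eqP->|/h kB].
  by rewrite le_max lexx.
by rewrite le_max kB orbT.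
Qed.

(** Decreases in time from 1 at [c] to 0 at [c + e], so that [dramp e c] below approximates a Dirac
    mass at [c]. *)
Definition ramp (e c : R) : V -> R := step \o (e^-1 \*: ((fun z => z.1) - cst c)).

Lemma Ck_ramp k e c : Ck k (ramp e c).
Proof. by apply/Ck_step/CkZ/CkB; [exact: Ck_time|exact: Ck_cst]. Qed.

Definition dramp (e c t : R) : R := e^-1 * dstep (e^-1 * (t - c)).

Lemma derive_ramp e c t x w : 'D_((1, w) : V) (ramp e c) (t, x) = - dramp e c t.
Proof.
have dl : is_derive ((t, x) : V) ((1, w) : V) (e^-1 \*: ((fun z => z.1) - cst c)) e^-1.
  apply: is_derive_affine => h.
  by rewrite /GRing.scale_fun/= !fctE/= /GRing.scale/=; ring.
rewrite derive_step_comp.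
  by case: dl => _ ->; rewrite mulrC.
have : Ck 1 (e^-1 \*: ((fun z : V => z.1) - cst c)).
  by apply/CkZ/CkB; [exact: Ck_time|exact: Ck_cst].
by case.
Qed.

Lemma dramp_ge0 e c t : 0 < e -> 0 <= dramp e c t.
Proof. by move=> e0; rewrite mulr_ge0 ?dstep_ge0// invr_ge0 ltW. Qed.

Lemma dramp_out e c t : 0 < e -> t <= c \/ c + e <= t -> dramp e c t = 0.
Proof.
move=> e0 [tc|ct]; rewrite /dramp.
  by rewrite dstep_le0 ?mulr0// pmulr_rle0 ?invr_gt0// subr_le0.
by rewrite dstep_ge1 ?mulr0// ler_pdivlMl// mulr1 lerBrDl.
Qed.

(** Each [dramp] has mass 1 and lives inside [0, T]. The fundamental theorem is applied once, to a
    primitive of the whole combination. *)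
Lemma integral_dramp (T e c : R) (al be c' : R) : 0 < T -> 0 < e ->
  0 <= c -> c + e <= T -> 0 <= c' -> c' + e <= T ->
  (\int[lebesgue_measure]_(t in `[0%R, T]) (al * dramp e c t - be * dramp e c' t)%:E
   = (al - be)%:E)%E.
Proof.
move=> T0 e0 c0 cT c'0 c'T.
pose S c (t : R) : R := step (e^-1 * (t - c)).
have dS k (t : R) : is_derive t (1 : R) (S k) (- dramp e k t).
  have dl : is_derive t (1 : R) (fun t => e^-1 * (t - k)) e^-1.
    by apply: is_derive_affine => h; rewrite /GRing.scale/=; ring.
  have := @is_derive1_comp _ step (fun t => e^-1 * (t - k)) t _ _ (is_derive_step _) dl.
  by rewrite mulNr mulrC.
pose F t := be * S c' t - al * S c t.
have dF (t : R) : is_derive t (1 : R) F (al * dramp e c t - be * dramp e c' t).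
  have := is_deriveB (is_deriveZ be (dS c' t)) (is_deriveZ al (dS c t)).
  by congr (is_derive _ _ _ _); rewrite /GRing.scale/=; ring.
have cF : continuous F.
  by move=> t; apply: differentiable_continuous; apply/derivable1_diffP; case: (dF t).
rewrite (@continuous_FTC2 _ _ F)//.
- have S0 k : 0 <= k -> S k 0 = 1.
    by move=> k0; rewrite /S step_le0// pmulr_rle0 ?invr_gt0// sub0r oppr_le0.
  have S1 k : k + e <= T -> S k T = 0.
    by move=> kT; rewrite /S step_ge1// ler_pdivlMl// mulr1 lerBrDl.
  by rewrite /F !S0// !S1// -EFinB; congr (_%:E); ring.
- apply: continuous_subspaceT => t.
  have cd k : continuous (dramp e k).
    have c1 : Ck 0 (idfun : R -> R) by apply: Ck_linear => z; exact: cvg_id.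
    have c2 : continuous (e^-1 \*: (idfun - cst k : R -> R)).
      exact: (CkZ e^-1 (CkB c1 (Ck_cst 0 k))).
    apply: (CkZ e^-1 (k := 0%N) (f := dstep \o (e^-1 \*: (idfun - cst k : R -> R)))).
    by move=> u; apply: continuous_comp; [exact: c2|exact: continuous_dstep].
  exact: (CkB (CkZ al (k := 0%N) (cd c)) (CkZ be (k := 0%N) (cd c'))).
- split; first by move=> t _; case: (dF t).
    by apply: cvg_at_right_filter; exact: cF.
  by apply: cvg_at_left_filter; exact: cF.
- by move=> t _; rewrite derive1E; case: (dF t).
Qed.

End balls_and_ramps.

(** * The mass inequality on one time interval *)

Section ball_growth_step.
Context {R : realType} {n : nat} {p : R}.
Hypothesis p1 : 1 <= p.
Notation V := (R * 'rV[R]_n)%type.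
Variables (T : R) (mu : R -> Pp n p) (w : R -> 'rV[R]_n -> 'rV[R]_n).
Hypothesis cmu : continuous_curve T mu.
Hypothesis weak : forall f, test_function T f ->
  (\int[lebesgue_measure]_(t in `[0%R, T])
     \int[mu t]_x (dt f t x + dotp (gradx f t x) (w t x))%:E)%E = 0%E.
Variables (a b r rmax kappa theta L D : R) (s : seq ('rV[R]_n * 'rV[R]_n)).
Hypotheses (a0 : 0 <= a) (ab : a < b) (bT : b <= T) (r0 : 0 <= r).
Hypotheses (theta0 : 0 < theta) (rmax0 : 0 <= rmax) (L0 : 0 <= L) (D0 : 0 <= D).
Hypothesis kappaE : kappa = 2 * rmax * (L * rmax + D).
Hypothesis rmaxE : r ^+ 2 + kappa * (b - a) + theta <= rmax ^+ 2.
Hypothesis wE : forall t x, a < t < b ->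
  {in s, forall c, enorm (w t x - c.2) <= L * enorm (x - (c.1 + (t - a) *: c.2)) + D}.

Let kappa0 : 0 <= kappa.
Proof. by rewrite kappaE !mulr_ge0// addr_ge0// mulr_ge0. Qed.

Let av := avoid a r kappa theta s.

(** The time factor rises over [a + e, a + 2e] and falls over [b - 2e, b - e]. The margins [e] keep
    the closed support inside the open interval (0, T) even when [a = 0] or [b = T]. The space
    factor is compactly supported on that interval because there are finitely many bounded balls. *)
Let bump (e : R) : V -> R :=
  (ramp e (b - e - e) - ramp e (a + e)) * (cst 1 - av).

Let plateau_out e t (x : 'rV[R]_n) : 0 < e -> ~~ (a + e <= t <= b - e) -> e + e + e + e <= b - a ->
  ramp e (b - e - e) (t, x) - ramp e (a + e) (t, x) = 0.
Proof.
move=> e0; rewrite negb_and -!ltNge /ramp !fctE/= /GRing.scale/= => /orP[|] h eab.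
  by rewrite !step_le0 ?subrr// pmulr_rle0 ?invr_gt0//; lra.
by rewrite !step_ge1 ?subrr// ler_pdivlMl//; lra.
Qed.

Let plateau_ge0 e t (x : 'rV[R]_n) : 0 < e -> e + e + e + e <= b - a ->
  0 <= ramp e (b - e - e) (t, x) - ramp e (a + e) (t, x).
Proof.
move=> e0 eab; rewrite subr_ge0 step_nincr// !fctE/= /GRing.scale/=.
by rewrite ler_wpM2l ?invr_ge0 ?ltW//; lra.
Qed.

Let bump_test e : 0 < e -> e + e + e + e <= b - a -> test_function T (bump e).
Proof.
move=> e0 eab.
have [B hB] := seq_bound s (fun c => enorm c.1 + (b - a) * enorm c.2).
pose K := `[a + e, b - e] `*` [set x : 'rV[R]_n | enorm x <= rmax + B].
have cK : compact K by apply: compact_setX; [exact: segment_compact|exact: compact_enorm_ball].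
have sK : [set z | bump e z != 0] `<=` K.
  move=> [t x]; rewrite /= /bump !fctE mulf_eq0 negb_or subr_eq0 eq_sym => /andP[h1 h2].
  have tI : a + e <= t <= b - e.
    by apply: contraNT h1 => h; rewrite eq_sym -subr_eq0 plateau_out.
  split; first by rewrite /= in_itv.
  have tab : a <= t <= b by lra.
  have /hasP[c cs cr] : has (fun c => enorm (x - (c.1 + (t - a) *: c.2)) < rmax) s.
    apply: contraNT h2 => /hasPn h; rewrite subr_eq0 eq_sym; apply/eqP.
    apply: (avoid_far theta0 kappa0 rmax0 rmaxE tab) => c cs.
    by rewrite leNgt; exact: h.
  rewrite /= -(subrK (c.1 + (t - a) *: c.2) x).
  apply: (le_trans (enormD _ _)); apply: lerD; first exact: ltW.
  apply: le_trans (hB c cs); apply: (le_trans (enormD _ _)); rewrite lerD2l enormZ.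
  have [ta tb] : 0 <= t - a /\ t - a <= b - a by split; lra.
  by rewrite ler_wpM2r ?enorm_ge0// ger0_norm.
have clK : closure [set z | bump e z != 0] `<=` K.
  have K' : closed K by apply: compact_closed => //; exact: norm_hausdorff.
  by move=> z h; apply: K'; exact: closure_subset sK _ h.
split.
- move=> k; apply: CkM; first by apply: CkB; exact: Ck_ramp.
  by apply: CkB; [exact: Ck_cst|exact: Ck_avoid].
- exact: subclosed_compact (@closed_closure _ _) cK clK.
- move=> z /clK[]; rewrite /= in_itv/= => /andP[h1 h2] _ /=; apply/andP; split.
    by apply: lt_le_trans h1; rewrite ltr_wpDl.
  by apply: (le_lt_trans h2); rewrite ltrBlDr (le_lt_trans bT)// ltrDl.
Qed.

Let derive_bump e t x w' : 'D_((1, w') : V) (bump e) (t, x) =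
  (ramp e (b - e - e) (t, x) - ramp e (a + e) (t, x)) * - 'D_((1, w') : V) av (t, x)
  + (1 - av (t, x)) * (dramp e (a + e) t - dramp e (b - e - e) t).
Proof.
have dr c : is_derive ((t, x) : V) ((1, w') : V) (ramp e c) (- dramp e c t).
  apply: DeriveDef; last exact: derive_ramp.
  by have [h _] := Ck_ramp (n := n) 1 e c; exact: diff_derivable.
have da : is_derive ((t, x) : V) ((1, w') : V) av ('D_((1, w') : V) av (t, x)).
  apply: DeriveDef => //.
  by have [h _] := Ck_avoid a r kappa theta 1 s; exact: diff_derivable.
have [_ ->] := is_deriveM (is_deriveB (dr (b - e - e)) (dr (a + e)))
  (is_deriveB (is_derive_cst (1 : R) _ _) da).
rewrite sub0r opprK [- _ + _]addrC; congr (_ + _).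
Qed.

Let measurable_avoid t : measurable_fun setT (fun x => 1 - av (t, x)).
Proof.
apply: continuous_measurable_rV.
have cav : continuous av := continuousCk (Ck_avoid a r kappa theta 0 s).
have c1 : Ck 0 (fun x => av (t, x)).
  move=> x; apply: (@continuous_comp _ _ _ (fun x => (t, x)) av); last exact: cav.
  apply: (@cvg_pair _ _ _ (nbhs x) (nbhs t) (nbhs x) _ _ _ (cst t) id).
    exact: cvg_cst.
  exact: cvg_id.
exact: (CkB (Ck_cst 0 1) c1).
Qed.

Let avoid_norm t x : `|1 - av (t, x)| <= 1.
Proof.
have /andP[h0 h1] := avoid_ge0_le1 a r kappa theta s (t, x).
by rewrite ger0_norm /av; lra.
Qed.

(** If the mean dropped by [3 * e] from [a] to [b], testing the equation with the bump would give at
    least [al - be = e > 0] instead of 0. By continuity the mean is at least [al] while the bump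
    rises and at most [be] while it falls; at the other times the contribution is nonnegative. *)
Lemma le_mean_avoid : mean (mu a) (fun x => 1 - av (a, x)) <=
  mean (mu b) (fun x => 1 - av (b, x)).
Proof.
pose g t x := 1 - av (t, x).
pose m t := mean (mu t) (g t).
have T0 : 0 < T by move: a0 ab bT; lra.
have mg : forall t, measurable_fun setT (g t) := measurable_avoid.
have g1 : forall t x, `|g t x| <= 1 := avoid_norm.
have ba0 : 0 <= b - a by rewrite subr_ge0 ltW.
have [C C0 avC] := avoid_lipschitz theta0 kappa0 rmax0 rmaxE s ba0.
have gC t t' x x' : a <= t <= b -> a <= t' <= b ->
    `|g t x - g t' x'| <= C * (`|t - t'| + enorm (x - x')).
  move=> tab tab'; have := avC t t' x x' tab tab'; rewrite -normrN.
  by congr (`|_| <= _); rewrite /g /av; ring.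
rewrite leNgt; apply/negP => mba; rewrite -/(m a) -/(m b) in mba.
pose e := (m a - m b) / 3; have e0 : 0 < e by rewrite divr_gt0// subr_gt0.
have aab : a <= a <= b by rewrite lexx ltW.
have bab : a <= b <= b by rewrite lexx ltW.
have [d1 d10 hd1] := mean_continuous p1 cmu a0 bT aab C0 mg g1 gC e0.
have [d2 d20 hd2] := mean_continuous p1 cmu a0 bT bab C0 mg g1 gC e0.
(* The quarter makes room for both ramps and both margins, and places each ramp where the continuity
   estimate at its endpoint holds. *)
pose h := Num.min (Num.min d1 d2) (b - a) / 4.
have h0 : 0 < h by rewrite divr_gt0// !lt_min d10 d20 subr_gt0.
have [h1 h2 h3] : [/\ h * 4 <= d1, h * 4 <= d2 & h * 4 <= b - a].
  by rewrite /h divfK// !ge_min !lexx !orbT.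
have hab : h + h + h + h <= b - a by lra.
pose al := m a - e; pose be := m b + e.
have key t : t \in `[0, T] -> ((al * dramp h (a + h) t - be * dramp h (b - h - h) t)%:E <=
    \int[mu t]_x (dt (bump h) t x + dotp (gradx (bump h) t x) (w t x))%:E)%E.
  move=> tT.
  have [bk _] : Ck 1 (bump h) by have [] := bump_test h0 hab.
  have -> : (\int[mu t]_x (dt (bump h) t x + dotp (gradx (bump h) t x) (w t x))%:E =
    \int[mu t]_x ('D_((1, w t x) : V) (bump h) (t, x))%:E)%E.
    by apply: eq_integral => x _; rewrite material_derivative.
  (* Outside (a, b), where [wE] gives no control on the field, the time factor and both [dramp]
     vanish. *)
  have [tab|tab] := boolP (a < t < b); last first.
    have E1 : dramp h (a + h) t = 0.
      by apply: dramp_out => //; move: tab; rewrite negb_and -!leNgt => /orP[] ?; lra.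
    have E2 : dramp h (b - h - h) t = 0.
      by apply: dramp_out => //; move: tab; rewrite negb_and -!leNgt => /orP[] ?; lra.
    rewrite E1 E2 !mulr0 subrr integral_ge0// => x _.
    rewrite derive_bump E1 E2 plateau_out//; last by apply: contra tab => /andP[? ?]; lra.
    by rewrite mul0r add0r subrr mulr0.
  have tab' : a <= t <= b by lra.
  pose k := dramp h (a + h) t - dramp h (b - h - h) t.
  (* The term in which the plateau multiplies minus the derivative of [av] is nonnegative by
     [derive_avoid_le0], and is dropped. *)
  apply: (@le_trans _ _ (\int[mu t]_x (k * g t x)%:E)%E); last first.
    apply: le_integral_nomeas => x _; rewrite lee_fin derive_bump -/(g t x) mulrC lerDr.
    rewrite mulr_ge0// ?plateau_ge0// oppr_ge0.
    exact: (derive_avoid_le0 theta0 kappa0 rmax0 rmaxE L0 D0 tab' kappaE (wE x tab)).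
  under eq_integral do rewrite EFinM.
  rewrite integralZl//; last exact: (bounded_integrable (mu t) (mg t) (g1 t)).
  rewrite -(meanE (mu t) (mg t) (g1 t)) -EFinM lee_fin -/(m t) /k [leRHS]mulrBl.
  have [u0 v0] := (dramp_ge0 (a + h) t h0, dramp_ge0 (b - h - h) t h0).
  apply: lerB.
    have [tI|tI] := boolP (a + h < t < a + h + h).
      rewrite mulrC ler_wpM2l//.
      have := hd1 t tab'; rewrite -/(m t) -/(m a) ger0_norm; last lra.
      by move=> /(_ _)/ler_normlP[]; [lra|rewrite /al; lra].
    rewrite dramp_out ?mulr0 ?mul0r//; move: tI; rewrite negb_and -!leNgt.
    by move=> /orP[]; [left|right]; lra.
  have [tI|tI] := boolP (b - h - h < t < b - h).
    rewrite mulrC ler_wpM2r//.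
    have := hd2 t tab'; rewrite -/(m t) -/(m b) distrC ger0_norm; last lra.
    by move=> /(_ _)/ler_normlP[]; [lra|rewrite /be; lra].
  rewrite dramp_out ?mulr0 ?mul0r//; move: tI; rewrite negb_and -!leNgt.
  by move=> /orP[]; [left|right]; lra.
(* Nothing is known about the measurability in [t] of the inner integral, hence the passage through
   [le_integral_nomeas]. *)
have : (\int[lebesgue_measure]_(t in `[0%R, T])
    (al * dramp h (a + h) t - be * dramp h (b - h - h) t)%:E <=
  \int[lebesgue_measure]_(t in `[0%R, T])
    \int[mu t]_x (dt (bump h) t x + dotp (gradx (bump h) t x) (w t x))%:E)%E.
  by apply: le_integral_nomeas => t tT; exact: key.
rewrite (weak (bump_test h0 hab)) integral_dramp//; last 4 first.
- by move: a0 ab bT; lra.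
- by move: a0 ab bT; lra.
- by move: a0 ab bT; lra.
- by move: a0 ab bT; lra.
by rewrite lee_fin /al /be /e; lra.
Qed.

(** [1 - av] lies above the indicator of the initial balls at time [a] and below that of the
    enlarged balls at time [b]. *)
Lemma ball_growth_step : (mu a (balls [seq c.1 | c <- s] r) <=
  mu b (balls [seq (c.1 + (b - a) *: c.2)%R | c <- s] rmax))%E.
Proof.
have mE (m : probability 'rV[R]_n R) A : measurable A -> m A = (\int[m]_x (\1_A x)%:E)%E.
  by move=> mA; rewrite integral_indic// setIT.
apply: (@le_trans _ _ (mean (mu a) (fun x => 1 - av (a, x)))%:E).
  rewrite (meanE (mu a) (measurable_avoid a) (avoid_norm a)).
  rewrite [leLHS](mE (mu a)); last exact: measurable_balls.
  apply: le_integral_nomeas => x _; rewrite lee_fin indicE.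
  case: (boolP (x \in _)) => [|_].
    rewrite inE /balls/= has_map => /hasP[c cs /= xc].
    by rewrite /av (avoid_near a kappa theta0 r0 cs xc) subr0.
  by have /andP[_ h1] := avoid_ge0_le1 a r kappa theta s (a, x); rewrite subr_ge0.
apply: (@le_trans _ _ (mean (mu b) (fun x => 1 - av (b, x)))%:E).
  by rewrite lee_fin; exact: le_mean_avoid.
rewrite (meanE (mu b) (measurable_avoid b) (avoid_norm b)).
rewrite [leRHS](mE (mu b)); last exact: measurable_balls.
apply: le_integral_nomeas => x _; rewrite lee_fin indicE.
have /andP[h0 h1] := avoid_ge0_le1 a r kappa theta s (b, x).
case: (boolP (x \in _)) => [_|]; first by rewrite lerBlDr lerDl.
rewrite notin_setE /balls/= has_map => /negP/hasPn h.
rewrite /av (avoid_far theta0 kappa0 rmax0 rmaxE) ?subrr//.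
  by rewrite lexx ltW.
by move=> c cs; have := h c cs; rewrite /= -ltNge => /ltW.
Qed.

End ball_growth_step.

(** * Euler scheme and flow *)

Section euler_scheme.
Context {R : realType} {n : nat}.
Variables (t L M : R) (w : R -> 'rV[R]_n -> 'rV[R]_n).
Hypotheses (t0 : 0 <= t) (L0 : 0 <= L) (M0 : 0 <= M).
Hypothesis wL : forall s x y, enorm (w s x - w s y) <= L * enorm (x - y).
Hypothesis wM : forall s x, enorm (w s x) <= M.

(** Dyadic grids are nested: a node of level [k] stays a node of every finer level, and [t] is the
    last node of each. *)
Definition mesh k : R := t / (2 ^ k)%:R.

Definition time_modulus (h delta : R) : Prop :=
  forall s s', 0 <= s <= t -> 0 <= s' <= t -> `|s - s'| <= h ->
  forall x, enorm (w s x - w s' x) <= delta.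

Hypothesis wC : forall delta, 0 < delta -> exists2 h, 0 < h & time_modulus h delta.

Fixpoint euler k j (x : 'rV[R]_n) : 'rV[R]_n :=
  if j is i.+1 then euler k i x + mesh k *: w (i%:R * mesh k) (euler k i x)
  else x.

Lemma pow2_gt0 k : 0 < (2 ^ k)%:R :> R.
Proof. by rewrite ltr0n expn_gt0. Qed.

Lemma mesh_ge0 k : 0 <= mesh k.
Proof. by rewrite divr_ge0// ltW// pow2_gt0. Qed.

Lemma meshD k m : mesh k = (2 ^ m)%:R * mesh (k + m).
Proof.
rewrite /mesh expnD natrM; field.
by rewrite !(gt_eqF (pow2_gt0 _)).
Qed.

Lemma time_le k j : (j <= 2 ^ k)%N -> 0 <= j%:R * mesh k <= t.
Proof.
move=> jk; rewrite mulr_ge0 ?mesh_ge0//= /mesh mulrA ler_pdivrMr ?pow2_gt0// mulrC.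
by rewrite ler_wpM2l// ler_nat.
Qed.

Lemma growth_le k j : (j <= 2 ^ k)%N -> (1 + mesh k * L) ^+ j <= expR (t * L).
Proof.
move=> jk; have /andP[_ jt] := time_le jk.
apply: (@le_trans _ _ (expR (mesh k * L) ^+ j)).
  by rewrite lerXn2r ?nnegrE ?expR_ge0 ?addr_ge0 ?mulr_ge0 ?mesh_ge0// expR_ge1Dx.
by rewrite -expRM_natl ler_expR mulrA ler_wpM2r.
Qed.

Lemma euler_step_lipschitz k s x y :
  enorm ((x + mesh k *: w s x) - (y + mesh k *: w s y)) <=
  (1 + mesh k * L) * enorm (x - y).
Proof.
have -> : (x + mesh k *: w s x) - (y + mesh k *: w s y) =
    (x - y) + mesh k *: (w s x - w s y).
  by rewrite scalerBr opprD addrACA.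
apply: (le_trans (enormD _ _)); rewrite mulrDl mul1r lerD2l enormZ.
by rewrite ger0_norm ?mesh_ge0// -mulrA ler_wpM2l ?mesh_ge0.
Qed.

Lemma euler_lipschitz k j x y :
  enorm (euler k j x - euler k j y) <= (1 + mesh k * L) ^+ j * enorm (x - y).
Proof.
elim: j => [|j IH] /=; first by rewrite expr0 mul1r.
apply: (le_trans (euler_step_lipschitz _ _ _ _)).
by rewrite exprS -mulrA ler_wpM2l// addr_ge0// mulr_ge0 ?mesh_ge0.
Qed.

Lemma euler_speed k j i x :
  enorm (euler k (j + i) x - euler k j x) <= i%:R * mesh k * M.
Proof.
elim: i => [|i IH]; first by rewrite addn0 subrr enorm0 !mul0r.
rewrite addnS /= addrAC; apply: (le_trans (enormD _ _)).
rewrite -natr1 !mulrDl mul1r; apply: lerD => //.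
by rewrite enormZ ger0_norm ?mesh_ge0// ler_wpM2l ?mesh_ge0.
Qed.

(* One step of size [mesh k], compared with its subdivision into [2 ^ m]
   steps: the velocity along the subdivision stays close to its initial value. *)
Lemma euler_refine_step k m j i x delta :
  time_modulus (mesh k) delta -> (j < 2 ^ k)%N -> (i <= 2 ^ m)%N ->
  enorm (euler (k + m) (j * 2 ^ m + i) x - euler (k + m) (j * 2 ^ m) x
         - (i%:R * mesh (k + m)) *: w (j%:R * mesh k) (euler (k + m) (j * 2 ^ m) x))
  <= i%:R * mesh (k + m) * (delta + L * (mesh k * M)).
Proof.
move=> hdelta jk; set y := euler (k + m) (j * 2 ^ m) x; elim: i => [_|i IH im].
  by rewrite addn0 !mul0r scale0r !subrr enorm0.
have {}IH := IH (ltnW im).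
rewrite addnS /=; set z := euler _ (_ + i) x in IH *.
set s := (_ + i)%N%:R * _; set h' := mesh (k + m) in IH s *.
have h'0 : 0 <= h' := mesh_ge0 _.
have -> : z + h' *: w s z - y - (i.+1%:R * h') *: w (j%:R * mesh k) y =
    (z - y - (i%:R * h') *: w (j%:R * mesh k) y)
    + h' *: (w s z - w (j%:R * mesh k) y).
  by apply/rowP => l; rewrite !mxE -natr1; ring.
have -> : i.+1%:R * h' * (delta + L * (mesh k * M)) =
    i%:R * h' * (delta + L * (mesh k * M)) + h' * (delta + L * (mesh k * M)).
  by rewrite -natr1; ring.
apply: (le_trans (enormD _ _)); apply: lerD => //.
rewrite enormZ ger0_norm// ler_wpM2l//.
have -> : w s z - w (j%:R * mesh k) y =
    (w s z - w (j%:R * mesh k) z) + (w (j%:R * mesh k) z - w (j%:R * mesh k) y).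
  by rewrite addrA subrK.
have ih : i%:R * h' <= mesh k by rewrite (meshD k m) ler_wpM2r// ler_nat ltnW.
have sE : s = j%:R * mesh k + i%:R * h'.
  by rewrite /s (meshD k m) natrD natrM mulrDl mulrA.
apply: (le_trans (enormD _ _)); apply: lerD.
  apply: hdelta; last by rewrite sE addrAC subrr add0r ger0_norm// mulr_ge0.
    apply: time_le; apply: (@leq_trans (j.+1 * 2 ^ m)).
      by rewrite mulSn addnC leq_add2r ltnW.
    by rewrite expnD leq_mul2r jk orbT.
  by apply: time_le; exact: ltnW.
apply: (le_trans (wL _ _ _)); rewrite ler_wpM2l//.
apply: (le_trans (euler_speed _ _ _ _)); by rewrite ler_wpM2r.
Qed.

(** Each step adds a local error given by [euler_refine_step], and multiplies the earlier errors by
    at most [1 + mesh k * L]. *)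
Lemma euler_refine k m j x delta :
  time_modulus (mesh k) delta -> 0 <= delta -> (j <= 2 ^ k)%N ->
  enorm (euler (k + m) (j * 2 ^ m) x - euler k j x) <=
  j%:R * mesh k * (delta + L * (mesh k * M)) * (1 + mesh k * L) ^+ j.
Proof.
move=> hdelta delta0; elim: j => [_|j IH jk].
  by rewrite mul0n subrr enorm0 !mul0r.
have {}IH := IH (ltnW jk).
have h0 := mesh_ge0 k; have hL : 0 <= mesh k * L by rewrite mulr_ge0.
set Delta := delta + _ in IH *.
have D0 : 0 <= Delta by rewrite addr_ge0// !mulr_ge0.
have := @euler_refine_step k m j (2 ^ m) x delta hdelta jk (leqnn _).
rewrite -meshD -/Delta -mulSnr => H.
set A := euler _ (j.+1 * _) x in H *; set y := euler _ (j * _) x in H IH.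
have -> : A - euler k j.+1 x = (A - y - mesh k *: w (j%:R * mesh k) y) +
    ((y + mesh k *: w (j%:R * mesh k) y)
     - (euler k j x + mesh k *: w (j%:R * mesh k) (euler k j x))).
  by apply/rowP => l; rewrite !mxE; ring.
apply: (le_trans (enormD _ _)).
apply: (le_trans (lerD H (euler_step_lipschitz _ _ _ _))).
have g1 : 1 <= (1 + mesh k * L) ^+ j.+1 by rewrite exprn_ege1// lerDl.
have -> : j.+1%:R * mesh k * Delta * (1 + mesh k * L) ^+ j.+1 =
    mesh k * Delta * (1 + mesh k * L) ^+ j.+1 +
    (1 + mesh k * L) * (j%:R * mesh k * Delta * (1 + mesh k * L) ^+ j).
  by rewrite -natr1 exprS; ring.
apply: lerD; first by rewrite ler_peMr// mulr_ge0.
by rewrite ler_wpM2l// addr_ge0.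
Qed.

Lemma euler_cauchy k m j x delta :
  time_modulus (mesh k) delta -> 0 <= delta -> (j <= 2 ^ k)%N ->
  enorm (euler (k + m) (j * 2 ^ m) x - euler k j x) <=
  t * (delta + L * (mesh k * M)) * expR (t * L).
Proof.
move=> hdelta delta0 jk; apply: (le_trans (euler_refine _ _ hdelta delta0 jk)).
have /andP[j0 jt] := time_le jk.
have D0 : 0 <= delta + L * (mesh k * M) by rewrite addr_ge0// !mulr_ge0// mesh_ge0.
apply: ler_pM; last exact: growth_le.
- by rewrite mulr_ge0.
- by rewrite exprn_ge0// addr_ge0// mulr_ge0// mesh_ge0.
- by rewrite ler_wpM2r.
Qed.

Lemma mesh_nincr k m : mesh (k + m) <= mesh k.
Proof.
by rewrite (meshD k m) ler_peMl ?mesh_ge0// ler1n expn_gt0.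
Qed.

Lemma mesh_small e : 0 < e -> exists k, forall m, mesh (k + m) <= e.
Proof.
move=> e0; exists (Num.bound (t / e)) => m; apply: (le_trans (mesh_nincr _ _)).
rewrite /mesh ler_pdivrMr ?pow2_gt0// mulrC -ler_pdivrMr//.
have te0 : 0 <= t / e by rewrite divr_ge0// ltW.
apply: (le_trans (ltW (archi_boundP te0))).
by rewrite ler_nat; apply: ltnW; exact: ltn_expl.
Qed.

Lemma time_modulus_small delta : 0 < delta ->
  exists k, forall m, time_modulus (mesh (k + m)) delta.
Proof.
move=> /wC[h h0 hh]; have [k hk] := mesh_small h0; exists k => m s s' sT s'T ss'.
by apply: hh => //; exact: le_trans (hk m).
Qed.

(** The flow from time 0 to the dyadic time [j%:R * mesh k]; by [flow_refine] the value is the same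
    when that time is read on a finer grid. *)
Definition flow k j (x : 'rV[R]_n) : 'rV[R]_n :=
  lim (euler (k + m) (j * 2 ^ m) x @[m --> \oo]).

Lemma enorm_lim_le (u : nat -> 'rV[R]_n) l c :
  u @ \oo --> l -> (\forall m \near \oo, enorm (u m) <= c) -> enorm l <= c.
Proof.
move=> ul h.
have : (enorm (u m) @[m --> \oo] --> enorm l).
  by apply: (@cvg_comp _ _ _ u (@enorm R n) _ (nbhs l)) => //; exact: continuous_enorm.
move=> cu; rewrite -(cvg_lim _ cu)//.
by apply: limr_le => //; apply/cvg_ex; exists (enorm l).
Qed.

Lemma small_error e : 0 < e -> exists2 delta, 0 < delta & exists k0, forall k,
  (k0 <= k)%N -> time_modulus (mesh k) delta /\ delta + L * (mesh k * M) <= e.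
Proof.
move=> e0; exists (e / 2); first exact: divr_gt0.
have LM1 : 0 < L * M + 1 by rewrite ltr_wpDl// mulr_ge0.
have [k1 h1] := time_modulus_small (divr_gt0 e0 (ltr0n _ 2)).
have [k2 h2] := mesh_small (divr_gt0 (divr_gt0 e0 (ltr0n _ 2)) LM1).
exists (maxn k1 k2) => k; rewrite geq_max => /andP[k1k k2k]; split.
  by rewrite -(subnKC k1k); exact: h1.
have := h2 (k - k2)%N; rewrite subnKC// ler_pdivlMr// => h.
have := mesh_ge0 k; lra.
Qed.

Lemma euler_cauchy_small e : 0 < e -> exists k0, forall k m j x,
  (k0 <= k)%N -> (j <= 2 ^ k)%N ->
  enorm (euler (k + m) (j * 2 ^ m) x - euler k j x) <= e.
Proof.
move=> e0; have c0 : 0 < t * expR (t * L) + 1.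
  by rewrite ltr_wpDl// mulr_ge0 ?expR_ge0.
have [delta d0 [k0 hk]] := small_error (divr_gt0 e0 c0); exists k0 => k m j x k0k jk.
have [hmod herr] := hk k k0k.
apply: (le_trans (euler_cauchy m x hmod (ltW d0) jk)).
rewrite mulrAC; move: herr; rewrite ler_pdivlMr// => herr.
have : 0 <= delta + L * (mesh k * M).
  by rewrite addr_ge0 ?(ltW d0)// !mulr_ge0// mesh_ge0.
by move: herr; lra.
Qed.

Lemma flow_cvg k j x : (j <= 2 ^ k)%N ->
  euler (k + m) (j * 2 ^ m) x @[m --> \oo] --> flow k j x.
Proof.
move=> jk; apply: cauchy_cvg; apply: cauchy_exP => e e0.
have [k0 hk] := euler_cauchy_small (divr_gt0 e0 (ltr0n _ 2)).
(* The uniform estimate holds from level [k0] on, and [k] may be smaller: the grid is refined by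
   [k0] before comparing. *)
exists (euler (k + k0) (j * 2 ^ k0) x); exists k0 => //= m k0m.
rewrite -ball_normE/= -normrN opprB; apply: (le_lt_trans (norm_le_enorm _)).
apply: (@le_lt_trans _ _ (e / 2)); last by rewrite gtr_pMr// invf_lt1// ltr1n.
have := hk (k + k0)%N (m - k0)%N (j * 2 ^ k0)%N x (leq_addl _ _).
rewrite -addnA subnKC// -mulnA -expnD subnKC//; apply.
by rewrite expnD leq_mul2r jk orbT.
Qed.

Lemma flow0 k x : flow k 0 x = x.
Proof.
rewrite /flow (_ : (fun m => _) = cst x) ?lim_cst//.
Qed.

Lemma flow_refine k m j x : (j <= 2 ^ k)%N ->
  flow (k + m) (j * 2 ^ m) x = flow k j x.
Proof.
move=> jk; rewrite /flow; apply: cvg_lim => //.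
rewrite (_ : (fun i => _) = [sequence euler (k + (i + m)) (j * 2 ^ (i + m)) x]_i).
  by rewrite (@cvg_shiftn m _ (fun i => euler (k + i) (j * 2 ^ i) x)); exact: flow_cvg.
by apply/funext => i /=; rewrite -mulnA -expnD addnA addnAC (addnC i).
Qed.

Lemma flow_lipschitz k j x y : (j <= 2 ^ k)%N ->
  enorm (flow k j x - flow k j y) <= expR (t * L) * enorm (x - y).
Proof.
move=> jk; apply: enorm_lim_le; first by apply: cvgB; exact: flow_cvg.
apply: nearW => m; apply: (le_trans (euler_lipschitz _ _ _ _)).
rewrite ler_wpM2r ?enorm_ge0// growth_le//.
by rewrite expnD leq_mul2r jk orbT.
Qed.

(** The limit of [euler_refine_step] with [i = 2 ^ m]. This quantitative one-step expansion stands
    for the differential equation of the flow in all that follows. *)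
Lemma flow_step k j x delta : (j < 2 ^ k)%N -> time_modulus (mesh k) delta ->
  enorm (flow k j.+1 x - flow k j x - mesh k *: w (j%:R * mesh k) (flow k j x))
  <= mesh k * (delta + L * (mesh k * M)).
Proof.
move=> jk hmod.
have wc : continuous (w (j%:R * mesh k)) by exact: enorm_lipschitz_continuous (wL _).
apply: enorm_lim_le.
  apply: cvgB; last apply: cvgZl_tmp; last first.
    apply: (@cvg_comp _ _ _ _ (w (j%:R * mesh k)) _ (nbhs (flow k j x))).
      exact: (@flow_cvg k j x (ltnW jk)).
    exact: wc.
  by apply: cvgB; [exact: flow_cvg|exact: (@flow_cvg k j x (ltnW jk))].
apply: nearW => m.
have := euler_refine_step x hmod jk (leqnn (2 ^ m)).
by rewrite -meshD -mulSnr.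
Qed.

End euler_scheme.

(** * Transport by the flow *)

Section pushforward_probability.
Context {d d' : measure_display} {X : measurableType d} {Y : measurableType d'}
  {R : realType}.

Definition push (P : probability X R) (f : X -> Y) (mf : measurable_fun setT f) :
    probability Y R :=
  distribution P (HB.pack f (isMeasurableFun.Build _ _ _ _ f mf) : {mfun X >-> Y}).

End pushforward_probability.

(** * Probability measures compared on closed sets *)

Section closed_sets.
Context {R : realType} {n : nat}.
Implicit Types (A C : set 'rV[R]_n) (P Q : probability 'rV[R]_n R).

Lemma open_enorm_ball (c : 'rV[R]_n) r : open [set x | enorm (x - c) < r].
Proof.
have cf := @continuous_enorm_sub R n c.
exact: (open_comp (fun x _ => cf x) (@open_lt R r)).
Qed.

(** The centres are taken in [A] itself: when [A] lies in the preimage of a closed set by the flow,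
    their images lie in that closed set. *)
Lemma finite_net A r : compact A -> 0 < r ->
  exists2 ys, {in ys, forall y, A y} & A `<=` balls ys r.
Proof.
rewrite compact_cover => cA r0.
have [| |D DA AD] := cA 'rV[R]_n A (fun y => [set x | enorm (x - y) < r]).
- by move=> y _; exact: open_enorm_ball.
- by move=> x Ax; exists x => //=; rewrite subrr enorm0.
exists (finmap.enum_fset D) => [y yD|x /AD[y yD /= xy]]; first by have := DA y yD; rewrite inE.
by apply/hasP; exists y => //; exact: ltW.
Qed.

Definition thicken C r : set 'rV[R]_n :=
  \bigcup_(c in C) [set x | enorm (x - c) < r].

Lemma open_thicken C r : open (thicken C r).
Proof. by apply: bigcup_open => c _; exact: open_enorm_ball. Qed.

Lemma subset_thicken C r : 0 < r -> C `<=` thicken C r.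
Proof. by move=> r0 x Cx; exists x => //=; rewrite subrr enorm0. Qed.

Lemma thicken_nincr C : {homo (fun i => thicken C i.+1%:R^-1) : i j / (i <= j)%N >-> (j <= i)%O}.
Proof.
move=> i j ij; apply/subsetPset => x [c Cc /= h]; exists c => //=.
by apply: (lt_le_trans h); rewrite lef_pV2 ?posrE ?ltr0n// ler_nat.
Qed.

Lemma bigcap_thicken C : closed C -> \bigcap_i thicken C i.+1%:R^-1 = C.
Proof.
move=> cC; apply/seteqP; split => [x h|x Cx i _]; last first.
  by apply: subset_thicken Cx; rewrite invr_gt0 ltr0n.
apply: cC => U /nbhs_ballP[e /= e0 eU].
pose i := Num.bound e^-1.
have [c Cc /= xc] := h i I; exists c; split => //; apply: eU.
rewrite -ball_normE/=; apply: (le_lt_trans (norm_le_enorm _)); apply: (lt_trans xc).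
rewrite invf_plt ?posrE ?ltr0n//.
have e1 : 0 <= e^-1 by rewrite invr_ge0 ltW.
by apply: (lt_trans (archi_boundP e1)); rewrite ltr_nat.
Qed.

Lemma closed_thicken_cvg P C : closed C ->
  P (thicken C i.+1%:R^-1) @[i --> \oo] --> P C.
Proof.
move=> cC; rewrite -[in X in _ --> X](bigcap_thicken cC).
apply: nonincreasing_cvg_mu.
- rewrite (le_lt_trans (probability_le1 _ _))// ?ltry//.
  by apply: open_measurable_rV; exact: open_thicken.
- by move=> i; apply: open_measurable_rV; exact: open_thicken.
- by rewrite bigcap_thicken//; exact: closed_measurable_rV.
- exact: thicken_nincr.
Qed.

Lemma le_thicken P C (x : \bar R) : closed C ->
  (forall r, 0 < r -> (x <= P (thicken C r))%E) -> (x <= P C)%E.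
Proof.
move=> cC h; have cv := @closed_thicken_cvg P C cC.
rewrite -(cvg_lim _ cv)//; apply: lime_ge; first by apply/cvg_ex; exists (P C).
by apply: nearW => i; apply: h; rewrite invr_gt0 ltr0n.
Qed.

(** As both total masses are 1, complements give the reverse inequality on open sets. Applied to
    open thickenings of a closed set, it returns to that set by continuity from above. Open sets
    then form a generating class stable under intersection. *)
Lemma le_closed_eq P Q : (forall C, closed C -> (P C <= Q C)%E) ->
  forall A, measurable A -> P A = Q A.
Proof.
move=> PQ.
have fP (P' : probability 'rV[R]_n R) A : measurable A -> P' A = (fine (P' A))%:E.
  by move=> mA; rewrite fineK//; exact: fin_num_measure.
have QP U : open U -> (Q U <= P U)%E.
  move=> oU; have mU := open_measurable_rV oU.
  have := PQ _ (open_closedC oU); rewrite !probability_setC//.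
  by rewrite (fP P)// (fP Q)// -!EFinB !lee_fin lerD2l lerN2.
have QPc C : closed C -> P C = Q C.
  move=> cC; apply/eqP; rewrite eq_le PQ//=; apply: le_thicken => // r r0.
  apply: (@le_trans _ _ (Q (thicken C r))); last by apply: QP; exact: open_thicken.
  apply: le_measure; rewrite ?inE.
  - exact: closed_measurable_rV.
  - by apply: open_measurable_rV; exact: open_thicken.
  - exact: subset_thicken.
apply: (measure_unique (@open 'rV[R]_n) (fun _ => setT)) => //.
- by move=> A B oA oB; exact: openI.
- by move=> i; exact: openT.
- by rewrite bigcup_const//; exists 0%N.
- move=> U oU; have mU := measurableC (open_measurable_rV oU).
  have -> : U = ~` ~` U by rewrite setCK.
  rewrite [LHS](probability_setC P mU) [RHS](probability_setC Q mU).
  by rewrite (QPc (~` U))//; exact: open_closedC.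
- by move=> k; rewrite (le_lt_trans (probability_le1 _ _))// ltry.
Qed.

End closed_sets.

Section transport_by_flow.
Context {R : realType} {n : nat} {p : R}.
Hypothesis p1 : 1 <= p.
Variables (T t L M : R) (mu : R -> Pp n p) (w : R -> 'rV[R]_n -> 'rV[R]_n).
Hypotheses (t_gt0 : 0 < t) (tT : t <= T) (L0 : 0 <= L) (M0 : 0 <= M).
Hypothesis wL : forall s x y, enorm (w s x - w s y) <= L * enorm (x - y).
Hypothesis wM : forall s x, enorm (w s x) <= M.
Hypothesis wC : forall delta, 0 < delta -> exists2 h, 0 < h & time_modulus t w h delta.
Hypothesis cmu : continuous_curve T mu.
Hypothesis weak : forall f, test_function T f ->
  (\int[lebesgue_measure]_(t in `[0%R, T])
     \int[mu t]_x (dt f t x + dotp (gradx f t x) (w t x))%:E)%E = 0%E.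

Let t0 : 0 <= t. Proof. exact: ltW. Qed.
Notation mesh := (mesh t).
Notation flow := (flow t w).

Let mesh_gt0 k : 0 < mesh k.
Proof. by rewrite divr_gt0// pow2_gt0. Qed.

(** The centres follow chords of the flow, so they end exactly at its next positions. The deviation
    [eta] collects the time variation of the field, the error of the chord slope, and the motion of
    the centre during the step. *)
Lemma transport_step k j ys r rmax theta delta eta :
  (j < 2 ^ k)%N -> time_modulus t w (mesh k) delta -> 0 <= delta ->
  delta + (delta + L * (mesh k * M))
    + L * (mesh k * (M + (delta + L * (mesh k * M)))) <= eta ->
  0 <= r -> 0 <= rmax -> 0 < theta ->
  r ^+ 2 + 2 * rmax * (L * rmax + eta) * mesh k + theta <= rmax ^+ 2 ->
  (mu (j%:R * mesh k) (balls [seq flow k j y | y <- ys] r) <=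
   mu (j.+1%:R * mesh k) (balls [seq flow k j.+1 y | y <- ys] rmax))%E.
Proof.
move=> jk hmod delta0; set h := mesh k; set Delta := delta + L * (h * M) => De r0 rm0 theta0 rE.
have h0 : 0 < h := mesh_gt0 k.
have D0 : 0 <= Delta by rewrite addr_ge0// !mulr_ge0// ltW.
pose u y := h^-1 *: (flow k j.+1 y - flow k j y).
have uE y : enorm (u y - w (j%:R * h) (flow k j y)) <= Delta.
  have := flow_step t0 L0 M0 wL wM wC y jk hmod; rewrite -/h -/Delta.
  have -> : flow k j.+1 y - flow k j y - h *: w (j%:R * h) (flow k j y) =
      h *: (u y - w (j%:R * h) (flow k j y)).
    by rewrite scalerBr /u scalerA mulfV ?scale1r// gt_eqF.
  by rewrite enormZ gtr0_norm// ler_pM2l.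
have uM y : enorm (u y) <= M + Delta.
  rewrite -(subrK (w (j%:R * h) (flow k j y)) (u y)) addrC.
  by apply: (le_trans (enormD _ _)); apply: lerD.
have ba : j.+1%:R * h - j%:R * h = h by rewrite -natr1; ring.
have /andP[a0 _] : 0 <= j%:R * h <= t by apply: time_le => //; exact: ltnW.
have /andP[_ bt] : 0 <= j.+1%:R * h <= t by exact: time_le.
have eta0 : 0 <= eta.
  have hh := ltW h0; have MD : 0 <= M + Delta by rewrite addr_ge0.
  by apply: le_trans De; rewrite !addr_ge0// !mulr_ge0.
pose s := [seq (flow k j y, u y) | y <- ys].
have E1 : [seq c.1 | c <- s] = [seq flow k j y | y <- ys].
  by rewrite -map_comp; apply: eq_map.
have E2 : [seq c.1 + (j.+1%:R * h - j%:R * h) *: c.2 | c <- s] = [seq flow k j.+1 y | y <- ys].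
  rewrite -map_comp ba; apply: eq_map => y /=.
  by rewrite /u scalerA mulfV ?gt_eqF// scale1r addrC subrK.
have := @ball_growth_step _ _ _ p1 T mu w cmu weak (j%:R * h) (j.+1%:R * h) r rmax
  (2 * rmax * (L * rmax + eta)) theta L eta s.
rewrite E1 E2 ba.
apply => //; first by rewrite -subr_gt0 ba.
  exact: le_trans bt tT.
move=> tau x /andP[as_ sb] _ /mapP[y _ ->] /=.
set z := x - _.
have sa0 : 0 <= tau - j%:R * h by rewrite subr_ge0 ltW.
have sah : tau - j%:R * h <= h.
  by rewrite lerBlDl; apply: (le_trans (ltW sb)); rewrite -natr1 mulrDl mul1r.
have -> : w tau x - u y = (w tau x - w (j%:R * h) x)
    + ((w (j%:R * h) x - w (j%:R * h) (flow k j y)) + (w (j%:R * h) (flow k j y) - u y)).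
  by rewrite !addrA !subrK.
have e1 : enorm (w tau x - w (j%:R * h) x) <= delta.
  apply: hmod; rewrite ?ger0_norm//.
    by rewrite (le_trans a0 (ltW as_))/= (le_trans (ltW sb)).
  by rewrite a0 (le_trans _ bt)// ler_wpM2r ?ler_nat// ltW.
have e2 : enorm (w (j%:R * h) x - w (j%:R * h) (flow k j y)) <=
    L * (enorm z + h * (M + Delta)).
  apply: (le_trans (wL _ _ _)); rewrite ler_wpM2l//.
  have -> : x - flow k j y = z + (tau - j%:R * h) *: u y by rewrite /z opprD addrA subrK.
  apply: (le_trans (enormD _ _)); rewrite lerD2l enormZ ger0_norm//.
  by rewrite ler_pM// enorm_ge0.
have e3 := uE y; rewrite enormBC in e3.
apply: (le_trans (enormD _ _)); apply: (le_trans (lerD e1 (enormD _ _))).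
apply: (le_trans (lerD (lexx delta) (lerD e2 e3))).
apply: (@le_trans _ _ (L * enorm z + (delta + Delta + L * (h * (M + Delta)))));
  last by rewrite lerD2l.
by rewrite le_eqVlt; apply/orP; left; apply/eqP; ring.
Qed.

(** By [2 * rm * eta <= rm ^+ 2 + eta ^+ 2], the growth rate of the squared radius is at most
    [c * rm ^+ 2 + eta ^+ 2], where [rm] is the radius at the end of the step. With
    [theta = eta ^+ 2 * mesh k], a step thus requires [r ^+ 2 + 2 * eta ^+ 2 * mesh k <= (1 - c *
    mesh k) * rm ^+ 2]. The sequence [sq] satisfies this recursion since
    [(1 - q) * (1 + 2 * q) >= 1] for [q] in [0, 1/2]. *)
Let c := 2 * L + 1.
Let sq k eta r j := (1 + 2 * c * mesh k) ^+ j * (r ^+ 2 + 2 * eta ^+ 2 * (j%:R * mesh k)).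

Lemma transport_iter k j ys r eta delta :
  (j <= 2 ^ k)%N -> time_modulus t w (mesh k) delta -> 0 <= delta ->
  delta + (delta + L * (mesh k * M))
    + L * (mesh k * (M + (delta + L * (mesh k * M)))) <= eta ->
  0 <= r -> 0 < eta -> c * mesh k <= 1 / 2 ->
  (mu 0 (balls ys r) <=
   mu (j%:R * mesh k) (balls [seq flow k j y | y <- ys] (Num.sqrt (sq k eta r j))))%E.
Proof.
move=> + hmod delta0 De r0 eta0 ck; elim: j => [_|j IH jk].
  rewrite mul0r (_ : map _ _ = ys); last first.
    by rewrite -[RHS]map_id; apply: eq_map => y; rewrite /= flow0.
  by rewrite /sq expr0 mul1r mul0r mulr0 addr0 sqrtr_sqr ger0_norm.
apply: (le_trans (IH (ltnW jk))).
have h0 := mesh_gt0 k; have hh := ltW h0.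
have c0 : 0 <= c by rewrite addr_ge0// mulr_ge0.
have sq0 i : 0 <= sq k eta r i.
  by rewrite !mulr_ge0// ?exprn_ge0 ?addr_ge0 ?mulr_ge0 ?exprn_ge0// ltW.
apply: (@transport_step k j ys _ _ (eta ^+ 2 * mesh k) delta eta) => //.
  by rewrite mulr_gt0// exprn_gt0.
rewrite !sqr_sqrtr//; set rm := Num.sqrt _.
have rmE : rm ^+ 2 = sq k eta r j.+1 by rewrite sqr_sqrtr.
have rm0 : 0 <= rm := sqrtr_ge0 _.
rewrite -rmE.
have g1 : 1 <= (1 + 2 * c * mesh k) ^+ j by rewrite exprn_ege1// lerDl !mulr_ge0.
have H : (1 + 2 * c * mesh k) * (sq k eta r j + 2 * eta ^+ 2 * mesh k) <= rm ^+ 2.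
  rewrite rmE /sq [(1 + 2 * c * mesh k) ^+ j.+1]exprS -[leRHS]mulrA.
  apply: ler_wpM2l; first by rewrite addr_ge0// !mulr_ge0.
  set A := _ ^+ j in g1 *.
  have -> : A * (r ^+ 2 + 2 * eta ^+ 2 * (j.+1%:R * mesh k)) =
      A * (r ^+ 2 + 2 * eta ^+ 2 * (j%:R * mesh k)) + A * (2 * eta ^+ 2 * mesh k).
    by rewrite -[j.+1%:R]natr1; ring.
  by rewrite lerD2l ler_peMl// !mulr_ge0// ltW.
have e1 : 2 * rm * eta <= eta ^+ 2 + rm ^+ 2.
  by have := sqr_ge0 (eta - rm); rewrite sqrrB; lra.
have : sq k eta r j + 2 * eta ^+ 2 * mesh k <= (1 - c * mesh k) * rm ^+ 2.
  have X0 : 0 <= sq k eta r j + 2 * eta ^+ 2 * mesh k.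
    by rewrite addr_ge0// !mulr_ge0// ltW.
  apply: (@le_trans _ _ ((1 - c * mesh k) * ((1 + 2 * c * mesh k)
    * (sq k eta r j + 2 * eta ^+ 2 * mesh k)))); last first.
    by rewrite ler_wpM2l//; move: ck; lra.
  rewrite [leRHS]mulrA ler_peMl//.
  have := mulr_ge0 c0 hh; move: ck; set q := c * mesh k => ck q0.
  have -> : 2 * c * mesh k = 2 * q by rewrite /q mulrA.
  nra.
have := ler_wpM2r hh e1; rewrite /c; lra.
Qed.

Let le_balls (m : probability 'rV[R]_n R) cs r r' : r <= r' ->
  (m (balls cs r) <= m (balls cs r'))%E.
Proof.
move=> rr; apply: le_measure; rewrite ?inE; [exact: measurable_balls|exact: measurable_balls|].
by move=> x /hasP[y ys /= h]; apply/hasP; exists y => //=; exact: le_trans rr.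
Qed.

(** What matters is that [r] is chosen before the grid and the centres. [E] bounds the amplification
    of squared radii on every grid. The given grid is refined until the errors fall below [eta], and
    [r], [eta] are such that the two terms of the final squared radius are at most 1/4 and 3/4 of
    [rho ^+ 2]. *)
Lemma transport_balls rho : 0 < rho -> exists2 r, 0 < r &
  forall k j ys, (j <= 2 ^ k)%N ->
  (mu 0 (balls ys r) <= mu (j%:R * mesh k) (balls [seq flow k j y | y <- ys] rho))%E.
Proof.
move=> rho0.
pose E := expR (t * (2 * c)).
have c0 : 0 < c by rewrite ltr_wpDl// mulr_ge0.
have E1 : 1 <= E by rewrite -expR0 ler_expR mulr_ge0// mulr_ge0// ltW.
have E0 : 0 < E by rewrite (lt_le_trans _ E1).
pose r := rho / (2 * E).
have r0 : 0 < r by rewrite divr_gt0// mulr_gt0.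
pose eta := rho / (2 * E * (t + 1)).
have t1 : 0 < t + 1 by rewrite addr_gt0.
have eta0 : 0 < eta by rewrite divr_gt0// !mulr_gt0.
exists r => // k j ys jk.
have [delta d0 [k0 hk]] := small_error t0 L0 M0 wC (divr_gt0 eta0 (ltr0n _ 4)).
have [k1 hk1] := mesh_small t0 (divr_gt0 (divr_gt0 ltr01 (ltr0n _ 2)) c0).
pose m := (k0 + k1)%N.
have [hmod herr] := hk (k + m)%N (leq_trans (leq_addr k1 k0) (leq_addl k m)).
have hm : mesh (k + m) <= 1 / 2 / c.
  by have := hk1 (k + k0)%N; rewrite /m (addnC k0) addnCA addnA.
have jm : (j * 2 ^ m <= 2 ^ (k + m))%N by rewrite expnD leq_mul2r jk orbT.
have jE : j%:R * mesh k = (j * 2 ^ m)%N%:R * mesh (k + m) by rewrite natrM -mulrA -meshD.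
have h0 := mesh_gt0 (k + m).
have cm : c * mesh (k + m) <= 1 / 2 by rewrite mulrC -ler_pdivlMr.
have De : delta + (delta + L * (mesh (k + m) * M)) +
    L * (mesh (k + m) * (M + (delta + L * (mesh (k + m) * M)))) <= eta.
  have LM0 : 0 <= L * (mesh (k + m) * M) by rewrite !mulr_ge0// ltW.
  have Lh : L * mesh (k + m) <= 1 by move: cm; rewrite /c; have := ltW h0; lra.
  have X0 : 0 <= delta + L * (mesh (k + m) * M) by rewrite addr_ge0// ltW.
  have := ler_wpM2r X0 Lh; move: herr; lra.
have := transport_iter ys jm hmod (ltW d0) De (ltW r0) eta0 cm.
rewrite -jE => H; apply: (le_trans H).
rewrite (eq_map (fun y => flow_refine t0 L0 M0 wL wM wC m y jk)).
apply: le_balls.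
have [hh cc etae] := And3 (ltW h0) (ltW c0) (ltW eta0).
have /andP[u0 ut] : 0 <= j%:R * mesh k <= t by exact: time_le.
have gr : (1 + 2 * c * mesh (k + m)) ^+ (j * 2 ^ m) <= E.
  rewrite (mulrC _ (mesh _)); apply: growth_le => //.
  by rewrite mulr_ge0// ltW.
rewrite -[leRHS](ger0_norm (ltW rho0)) -sqrtr_sqr ler_wsqrtr// /sq -jE.
apply: (@le_trans _ _ (E * (r ^+ 2 + 2 * eta ^+ 2 * t))).
  apply: ler_pM => //.
  - by rewrite exprn_ge0// addr_ge0// !mulr_ge0.
  - by rewrite addr_ge0 ?sqr_ge0//; apply: mulr_ge0 => //; rewrite mulr_ge0 ?sqr_ge0.
  - by rewrite lerD2l ler_wpM2l// mulr_ge0// sqr_ge0.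
have -> : E * (r ^+ 2 + 2 * eta ^+ 2 * t) =
    rho ^+ 2 * (1 / (4 * E) + t / (2 * E * (t + 1) ^+ 2)).
  by rewrite /r /eta; field; rewrite !gt_eqF.
rewrite -[leRHS]mulr1 ler_wpM2l ?sqr_ge0//.
rewrite [leRHS](_ : 1 = 1 / 4 + 3 / 4); last by field.
apply: lerD.
  by rewrite !mul1r lef_pV2 ?posrE ?mulr_gt0//; move: E1; lra.
rewrite ler_pdivrMr ?mulr_gt0 ?exprn_gt0//.
have h1 : (t + 1) ^+ 2 <= E * (t + 1) ^+ 2 by rewrite ler_peMl ?sqr_ge0.
have h2 : 4 / 3 * t <= 2 * (t + 1) ^+ 2 by have := sqr_ge0 t; rewrite sqrrD; move: t0; lra.
have -> : 2 * E * (t + 1) ^+ 2 = 2 * (E * (t + 1) ^+ 2) by ring.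
by move: h1 h2; lra.
Qed.

Lemma continuous_flow k j : (j <= 2 ^ k)%N -> continuous (flow k j).
Proof.
move=> jk; apply: enorm_lipschitz_continuous => x y.
exact: (flow_lipschitz t0 L0 M0 wL wM wC _ _ jk).
Qed.

(** Compact pieces of the preimage have finite nets with centres in the preimage; the flow sends
    these centres into [C], so the final balls lie in a thickening of [C]. *)
Lemma transport_closed k j C : (j <= 2 ^ k)%N -> closed C ->
  (mu 0 (flow k j @^-1` C) <= mu (j%:R * mesh k) C)%E.
Proof.
move=> jk cC; apply: le_thicken => // rho rho0.
have cf := continuous_flow jk.
have cP : closed (flow k j @^-1` C) by exact: (closed_comp (fun x _ => cf x) cC).
(* Half of [rho], because the balls are closed and the thickening is open. *)
have [r r0 hr] := transport_balls (divr_gt0 rho0 (ltr0n _ 2)).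
pose A N := flow k j @^-1` C `&` [set x | enorm x <= N%:R].
have cA N : compact (A N).
  apply: (@subclosed_compact _ _ [set x | enorm x <= N%:R]).
  - apply: closedI => //; apply: compact_closed; last exact: compact_enorm_ball.
    exact: norm_hausdorff.
  - exact: compact_enorm_ball.
  - by move=> x [].
have mA N : measurable (A N).
  apply: closed_measurable_rV; apply: compact_closed => //; exact: norm_hausdorff.
have bigA : \bigcup_N A N = flow k j @^-1` C.
  apply/seteqP; split => [x [N _ []]//|x Cx]; exists (Num.bound (enorm x)) => //; split => //=.
  by rewrite ltW// archi_boundP// enorm_ge0.
have cv : (mu 0 \o A) N @[N --> \oo] --> mu 0 (\bigcup_N A N).
  apply: nondecreasing_cvg_mu => //; first by rewrite bigA; exact: closed_measurable_rV.
  move=> N N' NN'; apply/subsetPset => x [Cx /= xN]; split => //=.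
  by rewrite (le_trans xN)// ler_nat.
rewrite -bigA -(cvg_lim _ cv)//; apply: lime_le; first by apply/cvg_ex; eexists; exact: cv.
apply: nearW => N /=.
have [ys ysA Ays] := finite_net (cA N) r0.
apply: (@le_trans _ _ (mu 0 (balls ys r))).
  by apply: le_measure; rewrite ?inE//; exact: measurable_balls.
apply: (le_trans (hr k j ys jk)); apply: le_measure; rewrite ?inE.
- exact: measurable_balls.
- by apply: open_measurable_rV; exact: open_thicken.
move=> x /hasP[_ /mapP[y yys ->] /= xy]; exists (flow k j y); first by have [] := ysA y yys.
by rewrite /= (le_lt_trans xy)// gtr_pMr// invf_lt1// ltr1n.
Qed.

Theorem transport k j A : (j <= 2 ^ k)%N -> measurable A ->
  mu (j%:R * mesh k) A = mu 0 (flow k j @^-1` A).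
Proof.
move=> jk mA; have mf : measurable_fun setT (flow k j).
  by apply: continuous_measurable_rV_rV; exact: continuous_flow.
apply: esym; apply: (@le_closed_eq _ _ (push (mu 0) mf) (mu (j%:R * mesh k))) => // C cC.
exact: transport_closed.
Qed.

End transport_by_flow.

(** * Stability *)

Section wasserstein_of_images.
Context {R : realType} {n : nat} {p : R}.
Hypothesis p1 : 1 <= p.
Implicit Types m : Pp n p.

(** Convexity of the [p]-th power, with weights [al * D / S] and [be / S] where [S = al * D + be].
    Integrated against a coupling of cost at most [D ^ p], the right-hand side is at most [S ^ p]:
    this is Minkowski's inequality for a distance plus a constant. *)
Lemma powR_affine_le (al be D d : R) : 0 <= al -> 0 <= be -> 0 < D -> 0 <= d ->
  0 < al * D + be ->
  (al * d + be) `^ p <=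
  (al * D + be) `^ p * (al * D / (al * D + be) * (D `^ p)^-1 * d `^ p + be / (al * D + be)).
Proof.
move=> al0 be0 D0 d0; set S := al * D + be => S0.
have l0 : 0 <= al * D / S by rewrite divr_ge0 ?mulr_ge0// ltW.
have l1 : al * D / S <= 1 by rewrite ler_pdivrMr// mul1r /S lerDl.
have := @convex_powR R p p1 (Itv01 l0 l1) (S * (d / D)) S.
have Sd0 : 0 <= S * (d / D) by rewrite mulr_ge0 ?divr_ge0// ltW.
rewrite !inE/= !in_itv/= !andbT => /(_ Sd0 (ltW S0)).
rewrite !convRE/= /unstable.onem => h.
have Sn : S != 0 by rewrite gt_eqF.
have E1 : al * d + be = al * D / S * (S * (d / D)) + (1 - al * D / S) * S.
  rewrite mulrBl mul1r divfK ?gt_eqF// {3}/S (addrAC _ be) subrr add0r; congr (_ + _).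
  by field; rewrite !gt_eqF.
rewrite E1; apply: (le_trans h); rewrite le_eqVlt; apply/orP; left; apply/eqP.
rewrite powRM ?divr_ge0 ?(ltW S0) ?(ltW D0)// powRM ?invr_ge0 ?(ltW D0)//.
have -> : (D^-1) `^ p = (D `^ p)^-1 by rewrite -powR_inv1 ?(ltW D0)// powRAC powR_inv1// powR_ge0.
have -> : 1 - al * D / S = be / S.
  by apply: (mulIf Sn); rewrite mulrBl mul1r !divfK// /S; ring.
by ring.
Qed.

Lemma integral_push d (X : measurableType d) (P : probability X R)
    (f : X -> 'rV[R]_n * 'rV[R]_n) (mf : measurable_fun setT f) :
  (\int[push P mf]_z (enorm (z.1 - z.2) `^ p)%:E =
   \int[P]_x (enorm ((f x).1 - (f x).2) `^ p)%:E)%E.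
Proof.
rewrite ge0_integral_distribution//; first exact: measurable_cost.
by move=> z; rewrite lee_fin powR_ge0.
Qed.

Lemma Wp_images m1 m2 m1' m2' (F G : 'rV[R]_n -> 'rV[R]_n) pi (al be D : R) :
  measurable_fun setT F -> measurable_fun setT G ->
  (forall A, measurable A -> m1' A = m1 (F @^-1` A)) ->
  (forall A, measurable A -> m2' A = m2 (G @^-1` A)) ->
  coupling m1 m2 pi -> 0 <= al -> 0 <= be -> 0 < D -> 0 < al * D + be ->
  (\int[pi]_z (enorm (z.1 - z.2) `^ p)%:E <= (D `^ p)%:E)%E ->
  (forall x y, enorm (F x - G y) <= al * enorm (x - y) + be) ->
  (Wp m1' m2' <= (al * D + be)%:E)%E.
Proof.
move=> mF mG F1 G2 cpi al0 be0 D0 S0 piD FG.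
have p0 : 0 < p by rewrite (lt_le_trans _ p1).
pose f z := (F z.1, G z.2).
have mf : measurable_fun setT f.
  apply: measurable_fun_pair; first exact: measurableT_comp mF measurable_fst.
  exact: measurableT_comp mG measurable_snd.
apply: (@Wp_le _ _ _ p1 _ _ (push pi mf)); first exact: ltW.
  move=> A mA; split.
    rewrite (F1 A mA); apply: (cpi (F @^-1` A) _).1.
    by rewrite -[X in measurable X]setTI; exact: mF.
  rewrite (G2 A mA); apply: (cpi (G @^-1` A) _).2.
  by rewrite -[X in measurable X]setTI; exact: mG.
rewrite integral_push /=; set S := al * D + be.
pose u := S `^ p * (al * D / S * (D `^ p)^-1).
pose v := S `^ p * (be / S).
have u0 : 0 <= u by rewrite /u !mulr_ge0 ?invr_ge0 ?powR_ge0// ltW.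
have v0 : 0 <= v by rewrite /v !mulr_ge0 ?invr_ge0 ?powR_ge0// ltW.
apply: (@le_trans _ _ (\int[pi]_z (u%:E * (enorm (z.1 - z.2) `^ p)%:E + v%:E))%E).
  apply: le_integral_nomeas => z _; rewrite -EFinM -EFinD lee_fin.
  apply: (@le_trans _ _ ((al * enorm (z.1 - z.2) + be) `^ p)).
    by apply: ge0_ler_powR; rewrite ?nnegrE ?enorm_ge0 ?addr_ge0 ?mulr_ge0 ?enorm_ge0// ltW.
  apply: (le_trans (powR_affine_le al0 be0 D0 (enorm_ge0 _) S0)).
  by rewrite -/S mulrDr mulrA.
rewrite ge0_integralD//; last 2 first.
- by move=> z _; rewrite mule_ge0 ?lee_fin ?powR_ge0.
- by apply: measurable_funeM; exact: measurable_cost.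
rewrite ge0_integralZl_EFin//; last 2 first.
- by move=> z _; rewrite lee_fin powR_ge0.
- exact: measurable_cost.
rewrite probability_integral_cst.
apply: (@le_trans _ _ (u%:E * (D `^ p)%:E + v%:E)%E).
  by rewrite leeD2r// lee_wpmul2l// lee_fin.
rewrite -EFinM -EFinD lee_fin le_eqVlt; apply/orP; left; apply/eqP.
have Dp : D `^ p != 0 by rewrite gt_eqF// powR_gt0.
by rewrite /u /v -(mulrA (S `^ p)) divfK// -mulrDr -mulrDl divff ?mulr1// gt_eqF.
Qed.

Lemma same_measure_Wp m1 m1' m2 m2' : same_measure m1 m1' -> same_measure m2 m2' ->
  Wp m1 m2 = Wp m1' m2'.
Proof.
move=> h1 h2; rewrite /Wp (_ : coupling m1 m2 = coupling m1' m2')//.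
by apply/seteqP; split => pi cpi A mA; [rewrite -h1// -h2//|rewrite h1// h2//]; exact: cpi.
Qed.

Lemma Wp_same m1 m2 : same_measure m1 m2 -> Wp m1 m2 = 0%E.
Proof.
move=> h; apply/eqP; rewrite eq_le Wp_ge0 andbT.
have mf : measurable_fun setT (fun x : 'rV[R]_n => (x, x)).
  by apply: measurable_fun_pair; exact: measurable_id.
apply: (@Wp_le _ _ _ p1 _ _ (push m1 mf)) => //.
  by move=> A mA; split; [|exact: h].
rewrite integral_push/= integral0_eq ?lee_fin ?powR_ge0// => x _.
by rewrite subrr enorm0 powR0// gt_eqF// (lt_le_trans _ p1).
Qed.

End wasserstein_of_images.

(** * Gronwall estimate for two solutions *)

Section stability.
Context {R : realType} {n : nat} {p : R}.
Hypothesis p1 : 1 <= p.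
Variables (v : Pp n p -> 'rV[R]_n -> 'rV[R]_n) (L M K : R).
Hypotheses (L0 : 0 <= L) (M0 : 0 <= M) (K0 : 0 <= K).
Hypothesis vL : forall m x y, enorm (v m x - v m y) <= L * enorm (x - y).
Hypothesis vM : forall m x, enorm (v m x) <= M.
Hypothesis vK : forall m1 m2 W x, 0 <= W -> (Wp m1 m2 <= W%:E)%E ->
  enorm (v m1 x - v m2 x) <= K * W.

(** Continuity of the curve and [vK] make the velocity continuous in time uniformly in [x];
    compactness of [0, t] makes the modulus uniform in time. *)
Lemma velocity_modulus T t (mu : R -> Pp n p) : 0 <= t -> t <= T ->
  continuous_curve T mu -> forall delta, 0 < delta ->
  exists2 h, 0 < h & time_modulus t (fun s => v (mu s)) h delta.
Proof.
move=> t0 tT cmu delta delta0.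
have inT s : 0 <= s <= t -> s \in `[0, T].
  by move=> /andP[s0 st]; rewrite in_itv/= s0 (le_trans st tT).
pose P (h : R) (s : R) := 0 <= s <= t -> forall s', 0 <= s' <= t -> `|s - s'| <= h ->
  forall x, enorm (v (mu s) x - v (mu s') x) <= delta.
have cK : compact `[0, t] := @segment_compact R 0 t.
have /compact_near_coveringP/(_ R (0^'+) P _) := cK.
case.
  move=> s0; rewrite /= in_itv/= => s0t.
  pose D := delta / (2 * (K + 1)).
  have K1 : 0 < K + 1 by rewrite ltr_wpDl.
  have D0 : 0 < D by rewrite divr_gt0// mulr_gt0.
  have [d d0 hd] := continuous_curveP cmu (inT _ s0t) D0.
  have near_s0 s x : 0 <= s <= t -> `|s - s0| < d ->
      enorm (v (mu s) x - v (mu s0) x) <= delta / 2.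
    move=> st sd; apply: (le_trans (vK x (ltW D0) (ltW (hd s (inT s st) sd)))).
    apply: (@le_trans _ _ ((K + 1) * D)); first by rewrite ler_wpM2r ?ltW// ltrDl.
    by rewrite le_eqVlt; apply/orP; left; apply/eqP; rewrite /D; field; rewrite gt_eqF.
  exists ([set s : R | `|s - s0| < d / 2], [set h : R | h < d / 2]).
    split=> /=.
      have d2 : 0 < d / 2 by rewrite divr_gt0.
      by apply: filterS (nbhsx_ballx s0 _ d2) => s; rewrite -ball_normE/= distrC.
    by apply: nbhs_right_lt; rewrite divr_gt0.
  move=> [s h] /= [sd hdl] st s' s't ss' x.
  have -> : v (mu s) x - v (mu s') x = (v (mu s) x - v (mu s0) x) - (v (mu s') x - v (mu s0) x).
    by rewrite opprB addrA subrK.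
  apply: (le_trans (enormB _ _)); rewrite (splitr delta); apply: lerD; apply: near_s0 => //.
    by apply: (lt_trans sd); rewrite gtr_pMr// invf_lt1// ltr1n.
  have := ler_distD s s' s0; rewrite (distrC s' s); move: sd; lra.
move=> e /= e0 he; exists (e / 2); first by rewrite divr_gt0.
move=> s s' st s't ss' x; apply: (he (e / 2)) => //=.
- by rewrite sub0r normrN gtr0_norm ?divr_gt0// gtr_pMr// invf_lt1// ltr1n.
- by rewrite divr_gt0.
Qed.

Variables (T : R) (mu nu : R -> Pp n p).
Hypotheses (cmu : continuous_curve T mu) (cnu : continuous_curve T nu).
Let weak_solution (m : R -> Pp n p) := forall f, test_function T f ->
  (\int[lebesgue_measure]_(t in `[0%R, T])
     \int[m t]_x (dt f t x + dotp (gradx f t x) (v (m t) x))%:E)%E = 0%E.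
Hypotheses (wmu : weak_solution mu) (wnu : weak_solution nu).

(* Discrete Gronwall argument along the two flows, for a fixed coupling of the
   initial data. *)
Lemma Wp_growth t D eps : 0 < t -> t <= T -> 0 < D -> 0 < eps ->
  (Wp (mu 0) (nu 0) < D%:E)%E ->
  (Wp (mu t) (nu t) <= (expR (t * (L + K)) * (D + 2 * t * eps))%:E)%E.
Proof.
move=> t_gt0 tT D0 eps0 /(Wp_lt_coupling p1)[pi cpi piD].
have t0 := ltW t_gt0.
have mC := velocity_modulus t0 tT cmu; have nC := velocity_modulus t0 tT cnu.
pose wm s := v (mu s); pose wn s := v (nu s).
have wLm s x y : enorm (wm s x - wm s y) <= L * enorm (x - y) by exact: vL.
have wLn s x y : enorm (wn s x - wn s y) <= L * enorm (x - y) by exact: vL.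
have wMm s x : enorm (wm s x) <= M by exact: vM.
have wMn s x : enorm (wn s x) <= M by exact: vM.
have [d1 d10 [k1 h1]] := small_error t0 L0 M0 mC eps0.
have [d2 d20 [k2 h2]] := small_error t0 L0 M0 nC eps0.
pose k := (k1 + k2)%N; pose h := mesh t k.
have [m1 e1] := h1 k (leq_addr _ _); have [m2 e2] := h2 k (leq_addl _ _).
have h0 : 0 <= h := mesh_ge0 t0 k.
have LK0 : 0 <= h * (L + K) by rewrite mulr_ge0// addr_ge0.
pose F j := flow t wm k j; pose G j := flow t wn k j.
pose S j := (1 + h * (L + K)) ^+ j * (D + 2 * eps * (j%:R * h)).
have eps0' := ltW eps0; have D0' := ltW D0.
have S0 j : 0 < S j.
  by rewrite mulr_gt0 ?exprn_gt0 ?ltr_wpDr// !mulr_ge0.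
have mF j : (j <= 2 ^ k)%N -> measurable_fun setT (F j).
  move=> jk; apply: continuous_measurable_rV_rV.
  exact: (continuous_flow t_gt0 L0 M0 wLm wMm mC jk).
have mG j : (j <= 2 ^ k)%N -> measurable_fun setT (G j).
  move=> jk; apply: continuous_measurable_rV_rV.
  exact: (continuous_flow t_gt0 L0 M0 wLn wMn nC jk).
have trF j A (jk : (j <= 2 ^ k)%N) (mA : measurable A) :=
  transport p1 t_gt0 tT L0 M0 wLm wMm mC cmu wmu jk mA.
have trG j A (jk : (j <= 2 ^ k)%N) (mA : measurable A) :=
  transport p1 t_gt0 tT L0 M0 wLn wMn nC cnu wnu jk mA.
(* The separation bound is pointwise because the next step compares the fields at [F j x] and
   [G j y]. Its integrated value [S j] is recorded too, since it bounds the current [Wp], which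
   controls the gap between the two fields. *)
have main j : (j <= 2 ^ k)%N -> exists al be, [/\ 0 <= al, 0 <= be, al * D + be = S j &
    forall x y, enorm (F j x - G j y) <= al * enorm (x - y) + be].
  elim: j => [_|j IH jk].
    exists 1, 0; rewrite /S expr0 mul0r mulr0 !addr0 !mul1r; split=> // x y.
    by rewrite /F /G !flow0 mul1r addr0.
  have jk' := ltnW jk; have [al [be [al0 be0 alS FG]]] := IH jk'.
  have W : (Wp (mu (j%:R * h)) (nu (j%:R * h)) <= (S j)%:E)%E.
    rewrite -alS; apply: (Wp_images p1 (mF j jk') (mG j jk') _ _ cpi al0 be0 D0) => //.
    - by move=> A mA; exact: trF.
    - by move=> A mA; exact: trG.
    - by rewrite alS.
  have hL0 : 0 <= h * L by rewrite mulr_ge0.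
  exists ((1 + h * L) * al).
  (* [be'] is forced by the equality with [S j.+1]; [be'E] checks that it covers the constant errors
     of the step. *)
  pose be' := S j.+1 - (1 + h * L) * al * D; exists be'.
  have be'E : (1 + h * L) * be + h * K * S j + 2 * (h * eps) <= be'.
    have SS : (1 + h * (L + K)) * S j + 2 * (h * eps) <= S j.+1.
      have g1 : 1 <= (1 + h * (L + K)) ^+ j.+1 by rewrite exprn_ege1// lerDl.
      have -> : S j.+1 = (1 + h * (L + K)) * S j + (1 + h * (L + K)) ^+ j.+1 * (2 * (h * eps)).
        by rewrite /S -[j.+1%:R]natr1 [_ ^+ j.+1]exprS; ring.
      by rewrite lerD2l ler_peMl// !mulr_ge0.
    by rewrite /be' lerBrDr; apply: le_trans SS; rewrite -alS; lra.
  have be'0 : 0 <= be'.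
    apply: le_trans be'E.
    have u1 : 0 <= (1 + h * L) * be by rewrite mulr_ge0// addr_ge0.
    have u2 : 0 <= h * K * S j by apply: mulr_ge0; [rewrite mulr_ge0|exact: ltW].
    have u3 : 0 <= h * eps by rewrite mulr_ge0.
    lra.
  split=> //.
  - by rewrite mulr_ge0// addr_ge0.
  - by rewrite /be' addrC subrK.
  move=> x y; apply: (@le_trans _ _ ((1 + h * L) * enorm (F j x - G j y)
     + (h * K * S j + 2 * (h * eps)))); last first.
    have := ler_wpM2l (addr_ge0 ler01 hL0) (FG x y); move: be'E; lra.
  have r1 := flow_step t0 L0 M0 wLm wMm mC x jk m1.
  have r2 := flow_step t0 L0 M0 wLn wMn nC y jk m2.
  rewrite -/(F j.+1 x) -/(F j x) -/h in r1; rewrite -/(G j.+1 y) -/(G j y) -/h in r2.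
  set X := F j x in r1 *; set Y := G j y in r2 *.
  set wX := wm _ X in r1; set wY := wn _ Y in r2.
  have -> : F j.+1 x - G j.+1 y = (X - Y) + h *: (wX - wY)
      + ((F j.+1 x - X - h *: wX) - (G j.+1 y - Y - h *: wY)).
    by apply/rowP => i; rewrite !mxE; ring.
  have rr : enorm ((F j.+1 x - X - h *: wX) - (G j.+1 y - Y - h *: wY)) <= 2 * (h * eps).
    have -> : 2 * (h * eps) = h * eps + h * eps by ring.
    apply: (le_trans (enormB _ _)); apply: lerD.
      by apply: (le_trans r1); rewrite ler_wpM2l.
    by apply: (le_trans r2); rewrite ler_wpM2l.
  have wXY : enorm (wX - wY) <= L * enorm (X - Y) + K * S j.
    have -> : wX - wY = (wX - v (mu (j%:R * h)) Y) + (v (mu (j%:R * h)) Y - wY).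
      by rewrite addrA subrK.
    apply: (le_trans (enormD _ _)); apply: lerD; first exact: vL.
    by apply: vK => //; exact: ltW.
  apply: (le_trans (enormD _ _)); apply: (le_trans (lerD (enormD _ _) rr)).
  rewrite enormZ ger0_norm//; have := ler_wpM2l h0 wXY; lra.
have [al [be [al0 be0 alS FG]]] := main (2 ^ k)%N (leqnn _).
have tE : (2 ^ k)%:R * h = t by rewrite /h /mesh mulrC divfK// gt_eqF// pow2_gt0.
apply: (@le_trans _ _ (al * D + be)%:E).
  apply: (Wp_images p1 (mF _ (leqnn _)) (mG _ (leqnn _)) _ _ cpi al0 be0 D0) => //.
  - by move=> A mA; rewrite -{1}tE; exact: trF.
  - by move=> A mA; rewrite -{1}tE; exact: trG.
  - by rewrite alS.
rewrite lee_fin alS /S tE; apply: ler_pM.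
- by rewrite exprn_ge0// addr_ge0.
- by rewrite addr_ge0// !mulr_ge0.
- by apply: growth_le => //; rewrite addr_ge0.
- by rewrite lerD2l mulrAC.
Qed.

Lemma Wp_contraction t : 0 < t -> t <= T ->
  (Wp (mu t) (nu t) <= (expR (t * (L + K)))%:E * Wp (mu 0) (nu 0))%E.
Proof.
move=> t0 tT; have E0 : 0 < expR (t * (L + K)) by exact: expR_gt0.
have W0 := Wp_ge0 (mu 0) (nu 0).
have [Wfin|] := boolP (Wp (mu 0) (nu 0) \is a fin_num); last first.
  rewrite ge0_fin_numE// -leNgt leye_eq => /eqP->.
  by rewrite gt0_muley ?leey// lte_fin.
apply/lee_addgt0Pr => e e0; set r := fine (Wp (mu 0) (nu 0)).
have rE : Wp (mu 0) (nu 0) = r%:E by rewrite fineK.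
have r0 : 0 <= r by rewrite fine_ge0.
(* Solves [expR (t * (L + K)) * (e' + 2 * t * e') = e], with [e'] used both as the excess over the
   infimum and as the error of the scheme. *)
pose e' := e / (expR (t * (L + K)) * (1 + 2 * t)).
have t1 : 0 < 1 + 2 * t by rewrite ltr_wpDr// mulr_ge0// ltW.
have e'0 : 0 < e' by rewrite divr_gt0// mulr_gt0.
apply: (le_trans (Wp_growth t0 tT (D := r + e') (eps := e') _ e'0 _)).
- by rewrite ltr_wpDl.
- by rewrite rE lte_fin ltrDl.
rewrite rE -EFinM -EFinD lee_fin le_eqVlt; apply/orP; left; apply/eqP.
by rewrite /e'; field; rewrite !gt_eqF.
Qed.

End stability.

(** * Comparison of the constants and conclusion *)

Lemma expR_le_ceil {R : realType} (x y : R) : 0 <= y -> x <= y ->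
  expR x <= (2 * expR 1) ^ Num.ceil y.
Proof.
move=> y0 xy.
have := ceil_ge y; have : (0 <= Num.ceil y)%R by rewrite ceil_ge0 (lt_le_trans _ y0)// ltrN10.
case: (Num.ceil y) => // N _; rewrite -pmulrn => yN.
apply: (@le_trans _ _ (expR N%:R)); first by rewrite ler_expR (le_trans xy).
rewrite -exprnP -[N%:R]mulr1 expRM_natl.
by rewrite lerXn2r ?nnegrE ?mulr_ge0 ?expR_ge0// ler_peMl ?expR_ge0// ler1n.
Qed.

(** Serves the case of negative constants, where the factor in the claim may be smaller than 1: only
    the values 0 and [+oo] are preserved by every positive factor. *)
Lemma Wp_trivial {R : realType} {n : nat} {p : R} (m1 m2 : Pp n p) : 1 <= p ->
  (forall x y : 'rV[R]_n, enorm (x - y) = 0) ->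
  Wp m1 m2 = 0%E \/ Wp m1 m2 = +oo%E.
Proof.
move=> p1 h; have W0 := Wp_ge0 m1 m2.
have [Wfin|] := boolP (Wp m1 m2 \is a fin_num); last first.
  by rewrite ge0_fin_numE// -leNgt leye_eq => /eqP->; right.
left; apply/eqP; rewrite eq_le W0 andbT.
have : (Wp m1 m2 < (fine (Wp m1 m2) + 1)%:E)%E by rewrite EFinD fineK// lteDl// lte_fin.
move=> /(Wp_lt_coupling p1)[pi cpi _]; apply: (Wp_le p1 (lexx 0) cpi).
rewrite integral0_eq ?lee_fin ?powR_ge0// => z _.
by rewrite h powR0// gt_eqF// (lt_le_trans _ p1).
Qed.

Theorem theorem3 (R : realType) (n : nat) (p T : R) (hp : 1 <= p) (hT : 0 < T)
    (v : Pp n p -> 'rV[R]_n -> 'rV[R]_n) (L M K : R)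
    (hv : hypothesis_H v L M K)
    (mu0 nu0 : Pp n p) (mu nu : R -> Pp n p)
    (hmu : solution v T mu0 mu) (hnu : solution v T nu0 nu) :
  (forall t : R, t \in `[0, T] ->
     (Wp (mu t) (nu t) <=
      ((2 * expR 1) ^ Num.ceil (t * Num.max (2 * L) (8 * K)))%:E
        * Wp mu0 nu0)%E)
  /\ (same_measure mu0 nu0 ->
      forall t : R, t \in `[0, T] -> same_measure (mu t) (nu t)).
Proof.
have [_ hL hM hK] := hv.
have [_ cmu mu00 wmu] := hmu; have [_ cnu nu00 wnu] := hnu.
(* The constants of the hypothesis carry no sign condition, whereas the Gronwall estimate is stated
   for nonnegative ones. *)
pose Lp := Num.max L 0; pose Kp := Num.max K 0.
have Lp0 : 0 <= Lp by rewrite le_max lexx orbT.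
have Kp0 : 0 <= Kp by rewrite le_max lexx orbT.
have M0 : 0 <= M := le_trans (enorm_ge0 _) (hM mu0 0).
have vL m x y : enorm (v m x - v m y) <= Lp * enorm (x - y).
  by apply: (le_trans (hL m x y)); rewrite ler_wpM2r ?enorm_ge0// le_max lexx.
have vK m1 m2 W x : 0 <= W -> (Wp m1 m2 <= W%:E)%E ->
    enorm (v m1 x - v m2 x) <= Kp * W.
  move=> W0 mW; rewrite -lee_fin EFinM.
  apply: (@le_trans _ _ (K%:E * Wp m1 m2)%E).
    by apply: le_trans (hK m1 m2); apply: ereal_sup_ubound; exists x.
  apply: (@le_trans _ _ (Kp%:E * Wp m1 m2)%E).
    by apply: lee_wpmul2r; [exact: Wp_ge0|rewrite lee_fin le_max lexx].
  by apply: lee_wpmul2l => //; rewrite lee_fin.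
have Wp0E : Wp (mu 0) (nu 0) = Wp mu0 nu0 by exact: same_measure_Wp.
have contr t : t \in `[0, T] ->
    (Wp (mu t) (nu t) <= (expR (t * (Lp + Kp)))%:E * Wp mu0 nu0)%E.
  rewrite in_itv/= le_eqVlt => /andP[/orP[/eqP<- _|t0 tT]].
    by rewrite mul0r expR0 mul1e Wp0E.
  by rewrite -Wp0E; exact: (Wp_contraction hp Lp0 M0 Kp0 vL hM vK cmu cnu wmu wnu).
split=> [t tT|m0n0 t tT].
  apply: (le_trans (contr t tT)).
  have W0 := Wp_ge0 mu0 nu0.
  have t0 : 0 <= t by move: tT; rewrite in_itv => /andP[].
  have [m0|m0] := leP 0 (Num.max (2 * L) (8 * K)).
    apply: lee_wpmul2r => //; rewrite lee_fin; apply: expR_le_ceil; first exact: mulr_ge0.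
    (* [Lp <= mx / 2] and [Kp <= mx / 8], so their sum is at most [mx]. *)
    rewrite ler_wpM2l//; move: m0; set mx := Num.max _ _ => m0.
    have l1 : 2 * L <= mx by rewrite le_max lexx.
    have l2 : 8 * K <= mx by rewrite le_max lexx orbT.
    by rewrite /Lp /Kp /Num.max; case: ifP => _; case: ifP => _; lra.
  have L_lt0 : L < 0 by move: m0; rewrite gt_max => /andP[]; lra.
  have triv (x y : 'rV[R]_n) : enorm (x - y) = 0.
    apply/eqP; rewrite eq_le enorm_ge0 andbT -(ler_nM2l L_lt0) mulr0.
    by apply: le_trans (hL mu0 x y); exact: enorm_ge0.
  have [->|->] := Wp_trivial mu0 nu0 hp triv; first by rewrite !mule0.
  by rewrite [leRHS]gt0_muley ?leey// lte_fin exprz_gt0// mulr_gt0 ?expR_gt0.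
(* Equality of the measures is not deduced from the vanishing of [Wp] at time [t]. That vanishing
   identifies the two velocity fields, so [mu] and [nu] solve one linear equation and are images of
   the same measure by the same flow. *)
have Wp00 : Wp mu0 nu0 = 0%E by exact: Wp_same.
have same_v s x : s \in `[0, T] -> v (mu s) x = v (nu s) x.
  move=> sT; apply/eqP; rewrite -subr_eq0; apply/eqP/enorm_eq0.
  apply/eqP; rewrite eq_le enorm_ge0 andbT -(mulr0 Kp); apply: vK => //.
  by apply: (le_trans (contr s sT)); rewrite Wp00 mule0.
have [t0|t0] := eqVneq t 0.
  by move=> A mA; rewrite t0 mu00// nu00// m0n0.
have {t0} [t0 t_le] : 0 < t /\ t <= T.
  by move: tT; rewrite in_itv/= => /andP[h1 h2]; rewrite lt_neqAle eq_sym t0 h1.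
pose w s := v (mu s).
have wnu' f : test_function T f ->
    (\int[lebesgue_measure]_(s in `[0%R, T])
       \int[nu s]_x (dt f s x + dotp (gradx f s x) (w s x))%:E = 0)%E.
  move=> tf; rewrite -[RHS](wnu f tf); apply: eq_integral => s; rewrite inE/= => sT.
  by apply: eq_integral => x _; rewrite /w same_v.
have wC := velocity_modulus Kp0 vK (ltW t0) t_le cmu.
have wL s x y : enorm (w s x - w s y) <= Lp * enorm (x - y) by exact: vL.
have wM s x : enorm (w s x) <= M by exact: hM.
move=> A mA.
(* Time [t] is the last node of the coarsest grid, so level 0 is enough to express the flow up to
   [t]. *)
have tE : (2 ^ 0)%N%:R * mesh t 0 = t by rewrite /mesh expn0 mul1r divr1.
have := transport hp t0 t_le Lp0 M0 wL wM wC cmu wmu (leqnn (2 ^ 0)) mA.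
have := transport hp t0 t_le Lp0 M0 wL wM wC cnu wnu' (leqnn (2 ^ 0)) mA.
rewrite tE => -> ->.
have mf : measurable (flow t w 0 (2 ^ 0) @^-1` A).
  rewrite -[X in measurable X]setTI; apply: continuous_measurable_rV_rV => //.
  exact: (continuous_flow t0 Lp0 M0 wL wM wC (leqnn _)).
by rewrite mu00// nu00// m0n0.
Qed.
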